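(* Let $c$ be a covering operator on $\mathbf{Comp}$ and let $H\in\mathbf{W}^*$ with $\mu(c)H=H$. Then $M$ is minimum in $\mathcal{V}(H,\mu(c))$ if and only if $YM$ is minimum in $\mathcal{S}(YH,c)$, $YM$ is zero-dimensional, and $M=F(YM)$.
   Context: Covers: $\mathbf{Comp}$ is the category of compact Hausdorff spaces and continuous maps. A continuous surjection $f:Y\to X$ in $\mathbf{Comp}$ is a covering map if $f(F)\neq X$ for every proper closed $F\subset Y$; then $(Y,f)$ is a cover of $X$. For covers of $X$, $(Y_1,f_1)\le(Y_2,f_2)$ iff there is a continuous $f:Y_2\to Y_1$ with $f_2=f_1\circ f$; covers $\le$ each other are identified, giving $\operatorname{cov}X$. Let $c$ assign to each $X\in\mathbf{Comp}$ a $(cX,c_X)\in\operatorname{cov}X$ and let $\operatorname{fix}(c)=\{X: c_X\text{ is a homeomorphism}\}$; $c$ is a covering operator if $(cX,c_X)$ is always the minimum in $\{(Y,f)\in\operatorname{cov}X:Y\in\operatorname{fix}(c)\}$. For $K\in\mathbf{Comp}$ with $cK=K$ (i.e. $K\in\operatorname{fix}(c)$), $\mathcal{S}(K,c)=\{X\in\mathbf{Comp}:cX=K\}$, where $X$ is identified with the pair $(X,c_X)$; i.e. the elements are pairs $(X,f)$, $f:K\to X$ a covering map with $(K,f)=(cX,c_X)$ in $\operatorname{cov}X$. Order: $(X_1,f_1)\le(X_2,f_2)$ iff there is a continuous $f:X_2\to X_1$ with $f_1=f\circ f_2$; pairs $\le$ each other are identified. Vector lattices: $\mathbf{W}^*$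 is the category of Archimedean vector lattices with distinguished strong unit and unit-preserving vector lattice homomorphisms. For $X\in\mathbf{Comp}$, $C(X)\in\mathbf{W}^*$ is the vector lattice of continuous real-valued functions on $X$ with unit the constant function $1$. An injective morphism $f:A\to B$ is essential if for every $0<b\in B$ there are $0<a\in A$ and $n\in\mathbb{N}$ with $f(a)\le nb$; then $(B,f)$ is an essential extension of $A$. For essential extensions of $A$, $(B_1,f_1)\le(B_2,f_2)$ iff there is a morphism $f:B_1\to B_2$ with $f_2=f\circ f_1$; extensions $\le$ each other are identified, giving $\operatorname{ext}A$. Yosida representation: for $A\in\mathbf{W}^*$ with unit $u$, the Yosida space $YA\in\mathbf{Comp}$ is the set of ideals maximal with respect to not containing $u$, with the hull-kernel topology. There is an injective morphism $\nu_A:A\to C(YA)$ whose image separates points, and $(YA,\nu_A)$ is unique up to homeomorphism with this property. Each morphism $f:A\to B$ induces a continuous $Yf:YB\to YA$ with $\nu_B(f(a))=\nu_A(a)\circ Yf$. $\mu(c)$ is the hull operator on $\mathbf{W}^*$ given by $\mu(c)A=C(cYA)$, with embedding $\mu(c)_A:A\to C(cYA)$, $\mu(c)_A(a)=\nu_A(a)\circ c_{YA}$. $\mu(c)H=H$ means $\mu(c)_H$ is an isomorphism. $\mathcal{V}(H,\mu(c))=\{A\in\mathbf{W}^*:\mu(c)A=H\}$, where $A$ is identified with the pair $(A,\mu(c)_A)$; i.e. the elements are pairs $(A,f)$, $f:A\to H$ an essential embedding with $(H,f)=(\mu(c)A,\mu(c)_A)$ in $\operatorname{ext}A$. Order: $(A_1,f_1)\le(A_2,f_2)$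 iff there is an essential embedding $f:A_1\to A_2$ with $f_1=f_2\circ f$; pairs $\le$ each other are identified. An element $(M,m)$ of $\mathcal{V}(H,\mu(c))$ has the associated pair $(YM,Ym)$ in $\mathcal{S}(YH,c)$. $F(K)=\{f\in C(K): f(K)\text{ is finite}\}$, and $M=F(YM)$ means $\nu_M(M)=F(YM)$. *)

(* Defs.v *)
Set Warnings "-notation-overridden,-ambiguous-paths,-notation-incompatible-prefix".
From HB Require Import structures.
From mathcomp Require Import all_boot all_order all_algebra.
From mathcomp Require Import all_classical all_reals topology normedtype.

Set Implicit Arguments.
Unset Strict Implicit.
Unset Printing Implicit Defensive.

Import Order.TTheory GRing.Theory Num.Theory.
Import numFieldNormedType.Exports.
Local Open Scope classical_set_scope.
Local Open Scope ring_scope.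

Definition minimum (T : Type) (le : T -> T -> Prop) (P : T -> Prop) (x : T) :=
  P x /\ forall y, P y -> le x y.

HB.mixin Record isCompactHausdorff T of Topological T := {
  compactT : compact [set: T];
  hausdorffT : hausdorff_space T
}.

#[short(type="compHausType")]
HB.structure Definition CompactHausdorff :=
  {T of Topological T & isCompactHausdorff T}.

Definition covering_map (Y X : compHausType) (f : continuousType Y X) :=
  range f = [set: X] /\
  forall F : set Y, closed F -> F <> [set: Y] -> f @` F <> [set: X].

Definition homeomorphism (Y X : compHausType) (f : continuousType Y X) :=
  exists g : continuousType X Y, cancel f g /\ cancel g f.

(* Elements of cov X are classes for [cov_eq]; a term of type [cov X] is a
   representative, and [minimum] is taken for the preorder [cov_le]. *)
Record cov (X : compHausType) := Cov {
  cov_space : compHausType;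
  cov_map : continuousType cov_space X;
  cov_mapP : covering_map cov_map }.

Definition cov_le (X : compHausType) (Y1 Y2 : cov X) :=
  exists f : continuousType (cov_space Y2) (cov_space Y1),
    cov_map Y2 =1 cov_map Y1 \o f.

Definition cov_eq (X : compHausType) (Y1 Y2 : cov X) :=
  cov_le Y1 Y2 /\ cov_le Y2 Y1.

Definition fix_cov (c : forall X, cov X) (X : compHausType) :=
  homeomorphism (cov_map (c X)).

Definition covering_operator (c : forall X, cov X) :=
  forall X, minimum (@cov_le X) (fun Y => fix_cov c (cov_space Y)) (c X).

(* [Num.POrderedZmodule] provides an order and a group structure without any
   compatibility between them, and MathComp has no join of [Lmodule] with
   [Order.Lattice]: the lattice operations and all compatibility axioms are
   fields here. *)
HB.mixin Record POrdered_isVectorLattice (R : numDomainType) V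
    of GRing.Lmodule R V & Num.POrderedZmodule V := {
  vmeet : V -> V -> V;
  vjoin : V -> V -> V;
  vlexI : forall x y z : V, (x <= vmeet y z) = (x <= y) && (x <= z);
  vleUx : forall x y z : V, (vjoin x y <= z) = (x <= z) && (y <= z);
  vlerD2r : forall z x y : V, x <= y -> x + z <= y + z;
  vscaler_ge0 : forall (k : R) (x : V), 0 <= k -> 0 <= x -> 0 <= k *: x
}.

#[short(type="vectorLatticeType")]
HB.structure Definition VectorLattice (R : numDomainType) :=
  {V of GRing.Lmodule R V & Num.POrderedZmodule V
      & POrdered_isVectorLattice R V}.

Definition vabs (R : numDomainType) (V : vectorLatticeType R) (x : V) : V :=
  vjoin x (- x).

HB.mixin Record VectorLattice_isWStar (R : numDomainType) V
    of VectorLattice R V := {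
  sunit : V;
  archimedeanP : forall a b : V, 0 <= a -> 0 <= b ->
    (forall n, a *+ n <= b) -> a = 0;
  sunit_ge0 : 0 <= sunit;
  sunitP : forall a : V, exists n, vabs a <= sunit *+ n
}.

#[short(type="wstarType")]
HB.structure Definition WStar (R : numDomainType) :=
  {V of VectorLattice R V & VectorLattice_isWStar R V}.

Record whom (R : numDomainType) (A B : wstarType R) := WHom {
  whom_fun :> A -> B;
  whom_linear : linear whom_fun;
  whom_meet : {morph whom_fun : x y / vmeet x y};
  whom_join : {morph whom_fun : x y / vjoin x y};
  whom_unit : whom_fun sunit = sunit }.

HB.instance Definition _ (R : numDomainType) (A B : wstarType R) (f : whom A B) :=
  @GRing.isLinear.Build _ _ _ _ (whom_fun f) (whom_linear f).

Section vector_lattice_theory.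
Variables (R : realFieldType) (V : vectorLatticeType R).
Implicit Types (x y z t : V) (k l : R).

Lemma vlerD x y z t : x <= y -> z <= t -> x + z <= y + t.
Proof.
move=> xy zt; apply: (le_trans (vlerD2r z _ _ xy)).
by rewrite ![y + _]addrC; exact: vlerD2r.
Qed.

Lemma vlerBlDr x y z : (x - y <= z) = (x <= z + y).
Proof.
apply/idP/idP => [/(vlerD2r y)|/(vlerD2r (- y))]; first by rewrite subrK.
by rewrite addrK.
Qed.

Lemma vlerBrDr x y z : (x <= y - z) = (x + z <= y).
Proof. by rewrite -{1}(opprK z) -[- - z]opprK -vlerBlDr !opprK. Qed.

Lemma vlerN2 x y : (- x <= - y) = (y <= x).
Proof. by rewrite -[- x]add0r vlerBlDr addrC vlerBrDr add0r. Qed.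

Lemma vsubr_ge0 x y : (0 <= y - x) = (x <= y).
Proof. by rewrite vlerBrDr add0r. Qed.

Lemma vlerZ k x y : 0 <= k -> x <= y -> k *: x <= k *: y.
Proof.
by move=> k0; rewrite -vsubr_ge0 => /(vscaler_ge0 _ _ k0); rewrite scalerBr vsubr_ge0.
Qed.

Lemma vlerZl k l x : 0 <= x -> k <= l -> k *: x <= l *: x.
Proof.
by move=> x0; rewrite -subr_ge0 => kl; rewrite -vsubr_ge0 -scalerBl vscaler_ge0.
Qed.

Lemma vler_pdivr k x y : 0 < k -> x <= k *: y -> k^-1 *: x <= y.
Proof.
move=> k0 /(vlerZ (ltW _)) => /(_ k^-1); rewrite invr_gt0 => /(_ k0).
by rewrite scalerA mulVf ?gt_eqF// scale1r.
Qed.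

Lemma vlejl x y : x <= vjoin x y.
Proof. by have := lexx (vjoin x y); rewrite vleUx => /andP[]. Qed.

Lemma vlejr x y : y <= vjoin x y.
Proof. by have := lexx (vjoin x y); rewrite vleUx => /andP[]. Qed.

Lemma vleml x y : vmeet x y <= x.
Proof. by have := lexx (vmeet x y); rewrite vlexI => /andP[]. Qed.

Lemma vlemr x y : vmeet x y <= y.
Proof. by have := lexx (vmeet x y); rewrite vlexI => /andP[]. Qed.

Lemma vabs_le x y : (vabs x <= y) = (x <= y) && (- x <= y).
Proof. exact: vleUx. Qed.

Lemma vle_abs x : x <= vabs x.
Proof. exact: vlejl. Qed.

Lemma vleN_abs x : - x <= vabs x.
Proof. exact: vlejr. Qed.

Lemma vabs_ge0 x : 0 <= vabs x.
Proof.
have : 0 <= 2 *: vabs x.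
  by rewrite (_ : 2 = 1 + 1)// scalerDl scale1r -(subrr x); apply: vlerD;
    [exact: vle_abs|exact: vleN_abs].
have h : 0 <= 2^-1 :> R by rewrite invr_ge0 ler0n.
by move=> /(vscaler_ge0 _ _ h); rewrite scalerA mulVf ?scale1r ?pnatr_eq0.
Qed.

Lemma vabs_id x : 0 <= x -> vabs x = x.
Proof.
move=> x0; apply/eqP; rewrite eq_le vle_abs andbT vabs_le lexx /=.
by apply: (le_trans _ x0); rewrite -oppr0 vlerN2.
Qed.

Lemma vabsN x : vabs (- x) = vabs x.
Proof. apply/eqP; rewrite eq_le !vabs_le opprK vle_abs vleN_abs vle_abs.
by have := vleN_abs (- x); rewrite opprK => ->. Qed.

Lemma vabsD x y : vabs (x + y) <= vabs x + vabs y.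
Proof.
by rewrite vabs_le opprD; apply/andP; split; apply: vlerD;
  rewrite ?vle_abs ?vleN_abs.
Qed.

Lemma vabsZ k x : vabs (k *: x) <= `|k| *: vabs x.
Proof.
wlog k0 : k x / 0 <= k.
  move=> h; have [k0|k0] := leP 0 k; first exact: h.
  by rewrite -normrN -[vabs x]vabsN -[k *: x]opprK -scaleNr -scalerN h// oppr_ge0 ltW.
by rewrite ger0_norm// vabs_le -scalerN !vlerZ ?vle_abs ?vleN_abs.
Qed.

Lemma vmeet_pos_neg x : vmeet (vjoin x 0) (vjoin (- x) 0) = 0.
Proof.
have xE : vjoin x 0 = x + vjoin (- x) 0.
  apply/eqP; rewrite eq_le vleUx.
  have := vlerD (lexx x) (vlejr (- x) 0); rewrite addr0 => ->.
  have := vlerD (lexx x) (vlejl (- x) 0); rewrite subrr => ->.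
  rewrite /= addrC -vlerBrDr vleUx !vlerBrDr addNr vlejr add0r.
  exact: vlejl.
apply/eqP; rewrite eq_le vlexI !vlejr !andbT.
set m := vmeet _ _; have m1 : m <= vjoin x 0 by exact: vleml.
have m2 : m <= vjoin (- x) 0 by exact: vlemr.
have : vjoin (- x) 0 <= vjoin (- x) 0 - m.
  rewrite vleUx !vlerBrDr add0r m2 andbT addrC vlerBlDr.
  by rewrite addrC -xE.
by rewrite vlerBrDr addrC -vlerBrDr subrr.
Qed.

End vector_lattice_theory.

(* Ideals of a vector lattice: solid linear subspaces. *)
Record lideal (R : numDomainType) (V : vectorLatticeType R) (I : set V) : Prop := {
  lideal0 : I 0;
  lidealD : forall x y, I x -> I y -> I (x + y);
  lidealZ : forall (k : R) x, I x -> I (k *: x);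
  lideal_solid : forall x y, I x -> vabs y <= vabs x -> I y }.

Definition unit_maximal (R : numDomainType) (A : wstarType R) (P : set A) :=
  [/\ lideal P, ~ P sunit
    & forall J : set A, lideal J -> ~ J sunit -> P `<=` J -> J = P].

Section ideal_theory.
Variables (R : realFieldType) (V : vectorLatticeType R) (I : set V).
Hypothesis idI : lideal I.

Lemma lidealN x : I x -> I (- x).
Proof. by move=> Ix; rewrite -scaleN1r; exact: lidealZ. Qed.

Lemma lideal_abs x : I x -> I (vabs x).
Proof. by move=> Ix; apply: (lideal_solid idI Ix); rewrite vabs_id ?vabs_ge0. Qed.

Lemma lideal_absV x : I (vabs x) -> I x.
Proof. by move=> Ix; apply: (lideal_solid idI Ix); rewrite (vabs_id (vabs_ge0 x)). Qed.

Lemma lideal_le x y : I x -> 0 <= y -> y <= x -> I y.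
Proof.
move=> Ix y0 yx; apply: (lideal_solid idI Ix).
by rewrite vabs_id// (le_trans yx)// vle_abs.
Qed.

(* x <= y modulo I. *)
Definition ple (x y : V) := exists2 m, I m & x <= y + m.

Lemma ple_pos x y : ple x y -> exists m, [/\ I m, 0 <= m & x <= y + m].
Proof.
move=> [m Im xym]; exists (vabs m); split; [exact: lideal_abs|exact: vabs_ge0|].
by apply: (le_trans xym); apply: vlerD => //; exact: vle_abs.
Qed.

Lemma le_ple x y : x <= y -> ple x y.
Proof. by exists 0; [exact: lideal0|rewrite addr0]. Qed.

Lemma ple_trans y x z : ple x y -> ple y z -> ple x z.
Proof.
move=> [m Im xy] [n In yz]; exists (n + m); first exact: lidealD.
by apply: (le_trans xy); rewrite addrA; apply: vlerD.
Qed.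

Lemma pleD x y z t : ple x y -> ple z t -> ple (x + z) (y + t).
Proof.
move=> [m Im xy] [n In yz]; exists (m + n); first exact: lidealD.
by rewrite addrACA; apply: vlerD.
Qed.

Lemma pleZ k x y : 0 <= k -> ple x y -> ple (k *: x) (k *: y).
Proof.
move=> k0 [m Im xy]; exists (k *: m); first exact: lidealZ.
by rewrite -scalerDr; apply: vlerZ.
Qed.

Lemma ple_I x : I x -> ple x 0.
Proof. by exists x => //; rewrite add0r. Qed.

Lemma ple_subr0 x y : ple (x - y) 0 <-> ple x y.
Proof.
split=> [[m Im xy]|[m Im xy]]; exists m => //; move: xy.
  by rewrite add0r vlerBlDr addrC.
by rewrite add0r vlerBlDr addrC.
Qed.

Lemma ple_anti x : ple x 0 -> ple 0 x -> I x.
Proof.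
move=> /ple_pos[m [Im m0 xm]] /ple_pos[n [In n0 xn]].
have Imn := lidealD idI Im In.
apply: (lideal_solid idI Imn); rewrite (vabs_id (x := m + n)); last first.
  by rewrite -[0]addr0; exact: vlerD.
rewrite vabs_le; apply/andP; split.
  by apply: (le_trans xm); rewrite add0r -{1}[m]addr0; exact: vlerD.
rewrite -[- x]add0r vlerBlDr; apply: (le_trans xn).
by rewrite [m + n]addrC -addrA [x + n]addrC -{1}[n]addr0 -addrA; do 2!apply: vlerD => //; rewrite -{1}[x]add0r vlerD2r.
Qed.

End ideal_theory.

Lemma sunit_natr (R : realType) (A : wstarType R) (a : A) :
  exists2 r : R, 0 <= r & vabs a <= r *: sunit.
Proof. by have [n an] := sunitP a; exists n%:R => //; rewrite scaler_nat. Qed.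

Section maximal_theory.
Variables (R : realType) (A : wstarType R) (P : set A).
Hypothesis maxP : unit_maximal P.
Local Notation u := (@sunit R A).
Implicit Types (a b x y : A) (r s k l : R).

Let idP : lideal P. Proof. by case: maxP. Qed.

Lemma ple_unit : ~ ple P u 0.
Proof.
move=> [m Pm um]; case: maxP => _ + _; apply.
by apply: (lideal_le idP Pm); rewrite ?sunit_ge0 // -[m]add0r.
Qed.

Lemma ple_Zunit r : ple P (r *: u) 0 -> r <= 0.
Proof.
move=> ru; rewrite leNgt; apply/negP => r0; apply: ple_unit.
have h : 0 <= r^-1 by rewrite invr_ge0 ltW.
by have := pleZ idP h ru; rewrite scalerA mulVf ?gt_eqF// scale1r scaler0.
Qed.

Lemma notP_unit x : ~ P x -> exists2 k, 0 < k & ple P u (k *: vabs x).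
Proof.
move=> nPx.
pose J := [set y | exists2 k, 0 <= k & ple P (vabs y) (k *: vabs x)].
have PJ : P `<=` J.
  move=> y Py; exists 0 => //; rewrite scale0r.
  by apply: (ple_I); exact: lideal_abs.
have Jx : J x by exists 1 => //; rewrite scale1r; exact: le_ple.
have idJ : lideal J.
  split.
  - by apply: PJ; exact: lideal0.
  - move=> y z [k k0 yk] [l l0 zl]; exists (k + l); first exact: addr_ge0.
    apply: (ple_trans idP (le_ple idP (vabsD _ _))).
    by rewrite scalerDl; exact: pleD.
  - move=> k y [l l0 yl]; exists (`|k| * l); first exact: mulr_ge0.
    apply: (ple_trans idP (le_ple idP (vabsZ _ _))).
    by rewrite -scalerA; exact: pleZ.
  - move=> y z [k k0 yk] zy; exists k => //.
    exact: (ple_trans idP (le_ple idP zy)).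
have [Ju|nJu] := pselect (J u); last first.
  by case: maxP => _ _ /(_ J idJ nJu PJ) JP; exfalso; apply: nPx; rewrite -JP.
case: Ju => k k0; rewrite vabs_id ?sunit_ge0// => uk; exists k => //.
rewrite lt_neqAle k0 andbT; apply/eqP => k00; apply: ple_unit.
by move: uk; rewrite -k00 scale0r.
Qed.

Lemma unit_maximal_prime x y :
  P (vmeet (vabs x) (vabs y)) -> P x \/ P y.
Proof.
move=> Pxy; apply: contrapT => /not_orP[nx ny].
have [k k0 /(ple_pos idP)[m [Pm m0 um]]] := notP_unit nx.
have [l l0 /(ple_pos idP)[n [Pn n0 un]]] := notP_unit ny.
move: um un; rewrite -!vlerBlDr => um un.
pose K := Num.max k l; have K0 : 0 < K by rewrite lt_max k0.
have x0 := vabs_ge0 x; have y0 := vabs_ge0 y.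
have /(vler_pdivr K0) h1 : u - (m + n) <= K *: vabs x.
  apply: (@le_trans _ _ (u - m)).
    by apply: vlerD => //; rewrite vlerN2 -{1}[m]addr0; exact: vlerD.
  by apply: (le_trans um); apply: vlerZl => //; rewrite le_max lexx.
have /(vler_pdivr K0) h2 : u - (m + n) <= K *: vabs y.
  apply: (@le_trans _ _ (u - n)).
    by apply: vlerD => //; rewrite vlerN2 -{1}[n]add0r; exact: vlerD.
  by apply: (le_trans un); apply: vlerZl => //; rewrite le_max lexx orbT.
apply: ple_unit.
exists (K *: vmeet (vabs x) (vabs y) + (m + n)).
  by apply: lidealD => //; [exact: lidealZ|exact: lidealD].
rewrite add0r -vlerBlDr.
have : K^-1 *: (u - (m + n)) <= vmeet (vabs x) (vabs y) by rewrite vlexI h1 h2.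
by move=> /(vlerZ (ltW K0)); rewrite scalerA divff ?gt_eqF// scale1r.
Qed.

Lemma ple_total x : ple P x 0 \/ ple P 0 x.
Proof.
have [Px|Px] : P (vjoin x 0) \/ P (vjoin (- x) 0).
- apply: unit_maximal_prime; rewrite !vabs_id ?vlejr// vmeet_pos_neg.
  exact: lideal0.
- by left; exists (vjoin x 0) => //; rewrite add0r vlejl.
- right; exists (vjoin (- x) 0) => //.
  by have := vlerD (lexx x) (vlejl (- x) 0); rewrite subrr.
Qed.

Lemma ple_abs x : ple P 0 x -> ple P (vabs x) x.
Proof.
move=> /(ple_pos idP)[m [Pm m0 xm]]; exists (m + m); first exact: lidealD.
rewrite vabs_le -{1}[x]addr0 vlerD//=; last by rewrite -[0]addr0 vlerD.
have := vlerD xm xm; rewrite addr0 -{1}(addNr x) => h.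
rewrite -[- x]add0r vlerBlDr addrC addrA [x + x]addrC.
by have := vlerD xm xm; rewrite addr0 addrACA addrA.
Qed.

Lemma ple_P a r : P (a - r *: u) <-> ple P a (r *: u) /\ ple P (r *: u) a.
Proof.
split=> [Pa|[h1 h2]].
  split; apply/ple_subr0; first exact: ple_I.
  by rewrite -opprB; apply: ple_I; exact: lidealN.
apply: ple_anti => //; first exact/ple_subr0.
by have := pleD idP h2 (le_ple idP (lexx (- (r *: u)))); rewrite subrr.
Qed.

Lemma residue_uniq a r s : P (a - r *: u) -> P (a - s *: u) -> r = s.
Proof.
move=> /ple_P[h1 h2] /ple_P[h3 h4]; apply/le_anti/andP.
split; rewrite -subr_le0; apply: ple_Zunit; rewrite scalerBl.
  by apply/ple_subr0; exact: (ple_trans idP h2 h3).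
by apply/ple_subr0; exact: (ple_trans idP h4 h1).
Qed.

Lemma residue_ex a : exists r, P (a - r *: u).
Proof.
have [n n0 an] := sunit_natr a.
pose S := [set r | ple P (r *: u) a].
have S0 : S !=set0.
  exists (- n); apply: le_ple => //.
  by rewrite scaleNr -vlerN2 opprK; apply: (le_trans _ an); exact: vleN_abs.
have ubS : has_ubound S.
  exists n => r Sr; rewrite -subr_le0; apply: ple_Zunit.
  rewrite scalerBl; apply/ple_subr0.
  apply: (ple_trans idP Sr); apply: le_ple => //.
  by apply: (le_trans _ an); exact: vle_abs.
exists (sup S); apply: contrapT => nP.
have [k k0 uk] := notP_unit nP.
have k1 : 0 <= k^-1 by rewrite invr_ge0 ltW.
have k1' : 0 < k^-1 by rewrite invr_gt0.
have {}uk : ple P (k^-1 *: u) (vabs (a - sup S *: u)).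
  by have := pleZ idP k1 uk; rewrite scalerA mulVf ?gt_eqF// scale1r.
have [|] := ple_total (a - sup S *: u).
  move=> h; have {}h : ple P 0 (- (a - sup S *: u)).
    have := pleD idP h (le_ple idP (lexx (- (a - sup S *: u)))).
    by rewrite subrr add0r.
  have := ple_trans idP uk; rewrite -vabsN => /(_ _ (ple_abs h)).
  rewrite opprB => /ple_subr0 h1.
  have [s Ss] := sup_adherent k1' (conj S0 ubS).
  apply/negP; rewrite -leNgt -subr_le0; apply: ple_Zunit.
  rewrite opprB addrA [s + _]addrC 2!scalerDl scaleNr.
  apply: (ple_trans idP _ h1).
  rewrite -addrA opprB; apply: pleD => //; first exact: le_ple.
  by apply: pleD => //; exact: le_ple.
move=> /ple_abs /(ple_trans idP uk) h.
have : S (k^-1 + sup S).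
  rewrite /S /= scalerDl; have := pleD idP h (le_ple idP (lexx (sup S *: u))).
  by rewrite subrK.
by move/(ub_le_sup ubS); rewrite gerDr leNgt k1'.
Qed.

End maximal_theory.

Lemma continuous_rays (R : realType) (T : topologicalType) (f : T -> R) :
  (forall r, open [set x | r < f x]) -> (forall r, open [set x | f x < r]) ->
  continuous f.
Proof.
move=> fgt flt x; apply/cvgrPdist_lt => e e0.
have n1 : nbhs x [set y | f x - e < f y].
  by apply: open_nbhs_nbhs; split; [exact: fgt|rewrite /= ltrBlDr ltrDl].
have n2 : nbhs x [set y | f y < f x + e].
  by apply: open_nbhs_nbhs; split; [exact: flt|rewrite /= ltrDl].
apply: (filterS _ (filterI n1 n2)) => y [/= h1 h2].
by rewrite ltr_distlC h1.
Qed.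

Section zorn.
Variables (R : realType) (A : wstarType R) (I0 : set A).
Hypotheses (idI0 : lideal I0) (nI0 : ~ I0 sunit).

Lemma unit_maximal_ex : exists P : set A, unit_maximal P /\ I0 `<=` P.
Proof.
pose good (I : set A) := [/\ lideal I, ~ I sunit & I0 `<=` I].
have [M [goodM maxM]] : exists M, (M = set0 \/ good M) /\
    forall B, M `<` B -> ~ (B = set0 \/ good B).
  apply: Zorn_bigcup => F FP totF.
  have [[X0 [FX0 gX0]]|nex] := pselect (exists X, F X /\ good X); last first.
    left; apply/seteqP; split=> // x [X FX Xx].
    have [X0|gX] := FP _ FX; first by rewrite X0 in Xx.
    by case: nex; exists X.
  have Fgood X x : F X -> X x -> good X.
    by move=> FX Xx; case: (FP _ FX) => // X0'; rewrite X0' in Xx.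
  right; case: gX0 => idX0 nX0 sX0; split; last first.
  - by move=> x /sX0 X0x; exists X0.
  - by move=> [X FX Xu]; have [_ + _] := Fgood _ _ FX Xu; apply.
  - split.
    + by exists X0 => //; exact: lideal0.
    + move=> x y [X FX Xx] [Y FY Yy].
      have [idX _ _] := Fgood _ _ FX Xx; have [idY _ _] := Fgood _ _ FY Yy.
      have [XY|YX] := totF _ _ FX FY.
        by exists Y => //; apply: lidealD => //; exact: XY.
      by exists X => //; apply: lidealD => //; exact: YX.
    + move=> k x [X FX Xx]; have [idX _ _] := Fgood _ _ FX Xx.
      by exists X => //; exact: lidealZ.
    + move=> x y [X FX Xx] yx; have [idX _ _] := Fgood _ _ FX Xx.
      by exists X => //; exact: lideal_solid yx.
have gM : good M.
  case: goodM => // M0; exfalso; apply: (maxM I0); last by right; split.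
  rewrite M0 properEneq; split => //; apply/eqP => h.
  by have := lideal0 idI0; rewrite -h.
case: gM => idM nM sM; exists M; split => //; split => // J idJ nJ MJ.
apply: contrapT => JM; apply: (maxM J); last by right; split=> // x /sM /MJ.
by rewrite properEneq; split => //; apply/eqP => h; apply: JM.
Qed.

End zorn.

Record yosida (R : realType) (A : wstarType R) := Yosida {
  yosida_ideal : set A;
  yosidaP : unit_maximal yosida_ideal }.

HB.instance Definition _ (R : realType) (A : wstarType R) :=
  gen_eqMixin (yosida A).
HB.instance Definition _ (R : realType) (A : wstarType R) :=
  gen_choiceMixin (yosida A).

Section yosida_topology.
Variables (R : realType) (A : wstarType R).
Implicit Types (P Q : yosida A).
Local Notation u := (@sunit R A).

Lemma yosida_eq P Q : yosida_ideal P = yosida_ideal Q -> P = Q.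
Proof.
by case: P Q => [P hP] [Q hQ] /= PQ; subst Q; congr Yosida; exact: Prop_irrelevance.
Qed.

Lemma yosida_lideal P : lideal (yosida_ideal P).
Proof. by case: (yosidaP P). Qed.

Lemma yosida_unit P : ~ yosida_ideal P u.
Proof. by case: (yosidaP P). Qed.

(* Hull-kernel topology: the closed sets are the hulls of subsets of A. *)
Definition hull (S : set A) : set (yosida A) := [set P | S `<=` yosida_ideal P].

Definition hk_open (U : set (yosida A)) := exists S, U = ~` hull S.

Lemma hk_openT : hk_open setT.
Proof.
exists [set u]; apply/seteqP; split=> // P _ h.
by apply: (@yosida_unit P); exact: h.
Qed.

Lemma hk_openI : setI_closed hk_open.
Proof.
move=> _ _ [S ->] [T ->].
exists [set z | exists2 x, S x & exists2 y, T y & z = vmeet (vabs x) (vabs y)].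
rewrite -setCU; congr (~` _); apply/seteqP; split=> P.
  have idP := yosida_lideal P.
  have pos (x y : A) : 0 <= vmeet (vabs x) (vabs y) by rewrite vlexI; apply/andP; split; exact: vabs_ge0.
  move=> [SP|TP] _ [x Sx [y Ty ->]].
    by apply: (lideal_le idP (lideal_abs idP (SP _ Sx))); rewrite ?pos ?vleml.
  by apply: (lideal_le idP (lideal_abs idP (TP _ Ty))); rewrite ?pos ?vlemr.
move=> h; have [SP|/existsNP[x /not_implyP[Sx nPx]]] := pselect (S `<=` yosida_ideal P).
  by left.
right=> y Ty; have [//|//] : yosida_ideal P x \/ yosida_ideal P y.
by apply: (unit_maximal_prime (yosidaP P)); apply: h; exists x => //; exists y.
Qed.

Lemma hk_open_bigU (I : Type) (f : I -> set (yosida A)) :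
  (forall i, hk_open (f i)) -> hk_open (\bigcup_i f i).
Proof.
move=> fop.
exists [set a | exists i, ~` hull [set a] `<=` f i].
apply/seteqP; split=> [P [i _ fiP] h|P].
  have [S fiE] := fop i; move: (fiP); rewrite fiE; apply => a Sa; apply: h.
  by exists i => Q nQ; rewrite fiE => hQ; apply: nQ => _ ->; exact: hQ.
move=> /existsNP[a /not_implyP[[i fi] nPa]]; exists i => //.
by apply: fi => h; apply: nPa; exact: h.
Qed.

HB.instance Definition _ :=
  isOpenTopological.Build (yosida A) hk_openT hk_openI hk_open_bigU.

Lemma yosida_openE (U : set (yosida A)) : open U <-> hk_open U.
Proof. by []. Qed.

Lemma open_cozero a : open [set P : yosida A | ~ yosida_ideal P a].
Proof.
apply/yosida_openE; exists [set a]; apply/seteqP; split=> P /=.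
  by move=> nPa h; apply: nPa; exact: h.
by move=> h Pa; apply: h => _ ->.
Qed.

Lemma yosida_compact : compact [set: yosida A].
Proof.
move=> F PF _.
pose I0 := [set a | F [set P : yosida A | yosida_ideal P a]].
have idI0 : lideal I0.
  split.
  - by apply: (filterS _ filterT) => P _; exact: lideal0 (yosida_lideal P).
  - move=> x y Fx Fy; rewrite /I0 /=; near=> P.
    by apply: (lidealD (yosida_lideal P)); near: P.
  - by move=> k x; apply: filterS => P /= Px; exact: (lidealZ (yosida_lideal P)).
  - move=> x y + yx; apply: filterS => P /= Px.
    exact: (lideal_solid (yosida_lideal P) Px).
have nI0 : ~ I0 u.
  move=> FU; have [P /= Pu] := filter_ex FU; exact: (@yosida_unit P).
have [M [maxM IM]] := unit_maximal_ex idI0 nI0.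
exists (Yosida maxM); split => // S U FS.
rewrite nbhsE => -[V [oV VM] VU].
have [T VE] := oV; move: VM; rewrite VE => /existsNP[a /not_implyP[Ta nMa]].
have nFa : ~ F [set P : yosida A | yosida_ideal P a].
  by move=> Fa; apply: nMa; exact: IM.
apply: contrapT => nSU; apply: nFa; apply: filterS FS => P SP /=.
apply: contrapT => nPa; apply: nSU; exists P; split => //; apply: VU; rewrite VE => h.
by apply: nPa; exact: h.
Unshelve. all: by end_near. Qed.

(* A / P is one-dimensional, spanned by the class of the unit: the value of a
   at P is the only real r such that a - r u belongs to P. *)
Definition yosida_val (a : A) (P : yosida A) : R :=
  xget 0 [set r | yosida_ideal P (a - r *: u)].

Lemma yosida_valP a P : yosida_ideal P (a - yosida_val a P *: u).
Proof.
rewrite /yosida_val; case: xgetP => [r -> //|].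
by have [r Pr] := residue_ex (yosidaP P) a => /(_ r).
Qed.

Lemma yosida_valE a P r : yosida_ideal P (a - r *: u) -> yosida_val a P = r.
Proof. by move=> h; apply: (residue_uniq (yosidaP P) (yosida_valP a P) h). Qed.

Lemma yosida_val0 a P : yosida_val a P = 0 <-> yosida_ideal P a.
Proof.
split=> [h|h]; first by have := yosida_valP a P; rewrite h scale0r subr0.
by apply: yosida_valE; rewrite scale0r subr0.
Qed.

Lemma ple_yosida_val P a b :
  ple (yosida_ideal P) a b <-> yosida_val a P <= yosida_val b P.
Proof.
have idP := yosida_lideal P; have maxP := yosidaP P.
have /(ple_P maxP)[a1 a2] := yosida_valP a P.
have /(ple_P maxP)[b1 b2] := yosida_valP b P.
split=> h.
  rewrite -subr_le0; apply: (ple_Zunit maxP); rewrite scalerBl; apply/ple_subr0.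
  by apply: (ple_trans idP a2); apply: (ple_trans idP h).
apply: (ple_trans idP a1); apply: (ple_trans idP _ b2); apply: (le_ple idP).
by apply: vlerZl => //; exact: sunit_ge0.
Qed.

Lemma yosida_val_linear P : linear (yosida_val ^~ P).
Proof.
have idP := yosida_lideal P.
move=> k a b; apply: yosida_valE.
rewrite scalerDl opprD addrACA -scalerA -scalerBr.
by apply: (lidealD idP); [apply: (lidealZ idP)|]; exact: yosida_valP.
Qed.

Lemma yosida_val_unit P : yosida_val u P = 1.
Proof.
by apply: yosida_valE; rewrite scale1r subrr; exact: lideal0 (yosida_lideal P).
Qed.

Lemma yosida_val_le P a b : a <= b -> yosida_val a P <= yosida_val b P.
Proof. by move=> ab; apply/ple_yosida_val; apply: (le_ple (yosida_lideal P)). Qed.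

Lemma yosida_val_meet P :
  {morph (yosida_val ^~ P) : a b / vmeet a b >-> Num.min a b}.
Proof.
have idP := yosida_lideal P; have maxP := yosidaP P.
move=> a b; apply/le_anti; rewrite le_min !yosida_val_le ?vleml ?vlemr//=.
have main x y z : z <= x -> (forall t, t <= x -> t <= y -> t <= z) ->
    yosida_val x P <= yosida_val y P -> yosida_val x P <= yosida_val z P.
  move=> zx xyz /ple_yosida_val /(ple_pos idP)[m [Pm m0 xym]]; apply/ple_yosida_val.
  exists m => //; rewrite -vlerBlDr; apply: xyz; last by rewrite vlerBlDr.
  by rewrite vlerBlDr -{1}[x]addr0; exact: vlerD.
have [ab|ba] := leP (yosida_val a P) (yosida_val b P).
  by apply: main ab; rewrite ?vleml// => t ta tb; rewrite vlexI ta.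
by apply: main (ltW ba); rewrite ?vlemr// => t ta tb; rewrite vlexI tb.
Qed.

Lemma yosida_val_join P :
  {morph (yosida_val ^~ P) : a b / vjoin a b >-> Num.max a b}.
Proof.
have idP := yosida_lideal P; have maxP := yosidaP P.
move=> a b; apply/le_anti; rewrite ge_max !yosida_val_le ?vlejl ?vlejr//= andbT.
have main x y z : (forall t, x <= t -> y <= t -> z <= t) ->
    yosida_val x P <= yosida_val y P -> yosida_val z P <= yosida_val y P.
  move=> xyz /ple_yosida_val /(ple_pos idP)[m [Pm m0 xym]]; apply/ple_yosida_val.
  by exists m => //; apply: xyz => //; rewrite -{1}[y]addr0; exact: vlerD.
have [ab|ba] := leP (yosida_val a P) (yosida_val b P).
  by apply: main ab => t ta tb; rewrite vleUx ta.
by apply: main (ltW ba) => t ta tb; rewrite vleUx tb.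
Qed.

Lemma yosida_valB P a b : yosida_val (a - b) P = yosida_val a P - yosida_val b P.
Proof.
have := yosida_val_linear P (- 1) b a.
by rewrite !scaleN1r ![- _ + _]addrC.
Qed.

Lemma yosida_valZu P r : yosida_val (r *: u) P = r.
Proof.
by apply: yosida_valE; rewrite subrr; exact: lideal0 (yosida_lideal P).
Qed.

Lemma open_yosida_gt a r : open [set P : yosida A | r < yosida_val a P].
Proof.
rewrite (_ : [set _ | _] =
    [set P | ~ yosida_ideal P (vjoin (a - r *: u) 0)]); first exact: open_cozero.
apply/seteqP; split=> P /= h; last first.
  rewrite ltNge; apply/negP => ar; apply: h; apply/yosida_val0.
  rewrite yosida_val_join yosida_valB yosida_valZu.
  by rewrite (iffRL (yosida_val0 _ _) (lideal0 (yosida_lideal P))) max_r// subr_le0.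
move/yosida_val0; rewrite yosida_val_join yosida_valB yosida_valZu.
rewrite (iffRL (yosida_val0 _ _) (lideal0 (yosida_lideal P))) => h0.
by move: h; rewrite -subr_gt0 => h; move: h0; rewrite max_l ?ltW// => h0; rewrite h0 ltxx in h.
Qed.

Lemma open_yosida_lt a r : open [set P : yosida A | yosida_val a P < r].
Proof.
rewrite (_ : [set _ | _] = [set P | - r < yosida_val (0 - a) P]).
  exact: open_yosida_gt.
apply/seteqP; split=> P /=;
  by rewrite yosida_valB (iffRL (yosida_val0 0 _) (lideal0 (yosida_lideal P))) sub0r ltrN2.
Qed.

Lemma yosida_val_continuous a : continuous (yosida_val a : yosida A -> R).
Proof.
apply: continuous_rays => r; [exact: open_yosida_gt|exact: open_yosida_lt].
Qed.

Lemma yosida_separates P Q :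
  (forall a, yosida_val a P = yosida_val a Q) -> P = Q.
Proof.
move=> PQ; apply: yosida_eq; apply/seteqP.
by split=> a /yosida_val0 h; apply/yosida_val0; rewrite -h PQ.
Qed.

Lemma yosida_hausdorff : hausdorff_space (yosida A).
Proof.
move=> P Q clPQ; apply: yosida_separates => a.
apply: (@Rhausdorff R) => U V nU nV.
have [S [SU SV]] := clPQ _ _ (@yosida_val_continuous a P U nU) (@yosida_val_continuous a Q V nV).
by exists (yosida_val a S).
Qed.

HB.instance Definition _ :=
  isCompactHausdorff.Build (yosida A) yosida_compact yosida_hausdorff.

End yosida_topology.

Definition Cfun (R : realType) (X : compHausType) := continuousType X R.

HB.instance Definition _ (R : realType) (X : compHausType) :=
  Choice.on (Cfun R X).

Section Cfun.
Variables (R : realType) (X : compHausType).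
Local Notation C := (Cfun R X).
Implicit Types (f g h : C).

Definition mkC (f : X -> R) (cf : continuous f) : C := mkcts cf.

Definition Cval (f : C) : X -> R := f.

Lemma CvalK f g : Cval f =1 Cval g -> f = g.
Proof. by move=> fg; apply/continuousEP. Qed.

Lemma C_cts f : continuous (Cval f).
Proof. exact: cts_fun. Qed.

Let add_cts f g : continuous (fun x => Cval f x + Cval g x).
Proof. by move=> x; apply: cvgD; exact: C_cts. Qed.

Let opp_cts f : continuous (fun x => - Cval f x).
Proof. by move=> x; apply: cvgN; exact: C_cts. Qed.

Let scale_cts (k : R) f : continuous (fun x => k * Cval f x).
Proof. by move=> x; apply: cvgM; [exact: cvg_cst|exact: C_cts]. Qed.

Let min_cts f g : continuous (fun x => Num.min (Cval f x) (Cval g x)).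
Proof. by move=> x; apply: continuous_min; exact: C_cts. Qed.

Let max_cts f g : continuous (fun x => Num.max (Cval f x) (Cval g x)).
Proof. by move=> x; apply: continuous_max; exact: C_cts. Qed.

Let cst_cts (k : R) : continuous (fun _ : X => k).
Proof. by move=> x; exact: cvg_cst. Qed.

Definition Cadd f g : C := mkC (@add_cts f g).
Definition Copp f : C := mkC (@opp_cts f).
Definition Cscale k f : C := mkC (@scale_cts k f).
Definition Cmin f g : C := mkC (@min_cts f g).
Definition Cmax f g : C := mkC (@max_cts f g).
Definition Ccst k : C := mkC (@cst_cts k).
Definition Cle f g := `[< forall x, Cval f x <= Cval g x >].

Let CaddA : associative Cadd.
Proof. by move=> f g h; apply: CvalK => x; exact: addrA. Qed.
Let CaddC : commutative Cadd.
Proof. by move=> f g; apply: CvalK => x; exact: addrC. Qed.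
Let Cadd0 : left_id (Ccst 0) Cadd.
Proof. by move=> f; apply: CvalK => x; exact: add0r. Qed.
Let CaddN : left_inverse (Ccst 0) Copp Cadd.
Proof. by move=> f; apply: CvalK => x; exact: addNr. Qed.
HB.instance Definition _ := GRing.isZmodule.Build C CaddA CaddC Cadd0 CaddN.

Let CscaleA a b f : Cscale a (Cscale b f) = Cscale (a * b) f.
Proof. by apply: CvalK => x; exact: mulrA. Qed.
Let Cscale1 : left_id 1 Cscale.
Proof. by move=> f; apply: CvalK => x; exact: mul1r. Qed.
Let CscaleDr : right_distributive Cscale +%R.
Proof. by move=> k f g; apply: CvalK => x; exact: mulrDr. Qed.
Let CscaleDl f : {morph Cscale^~ f : a b / a + b}.
Proof. by move=> a b; apply: CvalK => x; exact: mulrDl. Qed.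
HB.instance Definition _ :=
  GRing.Zmodule_isLmodule.Build R C CscaleA Cscale1 CscaleDr CscaleDl.

Let Cle_refl : reflexive Cle.
Proof. by move=> f; apply/asboolP. Qed.
Let Cle_anti : antisymmetric Cle.
Proof.
move=> f g /andP[/asboolP fg /asboolP gf]; apply: CvalK => x.
by apply/le_anti; rewrite fg gf.
Qed.
Let Cle_trans : transitive Cle.
Proof.
move=> g f h /asboolP fg /asboolP gh; apply/asboolP => x.
exact: le_trans (fg x) (gh x).
Qed.
HB.instance Definition _ :=
  Order.Le_isPOrder.Build ring_display C Cle_refl Cle_anti Cle_trans.

Lemma CleP f g : reflect (forall x, Cval f x <= Cval g x) (f <= g).
Proof. exact: asboolP. Qed.

Let ClexI f g h : (f <= Cmin g h) = (f <= g) && (f <= h).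
Proof.
apply/CleP/andP => [fgh|[/CleP fg /CleP fh] x]; last by rewrite /= le_min fg fh.
by split; apply/CleP => x; have := fgh x; rewrite /= le_min => /andP[].
Qed.
Let CleUx f g h : (Cmax f g <= h) = (f <= h) && (g <= h).
Proof.
apply/CleP/andP => [fgh|[/CleP fg /CleP fh] x]; last by rewrite /= ge_max fg fh.
by split; apply/CleP => x; have := fgh x; rewrite /= ge_max => /andP[].
Qed.
Let CleD f g h : g <= h -> g + f <= h + f.
Proof. by move=> /CleP gh; apply/CleP => x; rewrite lerD2r. Qed.
Let Cscale_ge0 (k : R) f : 0 <= k -> 0 <= f -> 0 <= k *: f.
Proof. by move=> k0 /CleP f0; apply/CleP => x; apply: mulr_ge0 => //; exact: f0. Qed.
HB.instance Definition _ :=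
  POrdered_isVectorLattice.Build R C ClexI CleUx CleD Cscale_ge0.

Lemma CmulrnE f n x : Cval (f *+ n) x = Cval f x *+ n.
Proof. by elim: n => // n ih; rewrite !mulrS -ih. Qed.

Let Carchi f g : 0 <= f -> 0 <= g -> (forall n, f *+ n <= g) -> f = 0.
Proof.
move=> /CleP f0 /CleP g0 fg; apply: CvalK => x; apply/le_anti; rewrite f0 andbT.
rewrite leNgt; apply/negP => fx0; have fx0' : 0 < Cval f x := fx0.
have := archi_boundP (divr_ge0 (g0 x) (f0 x)).
set n := Num.bound _; have /CleP/(_ x) := fg n; rewrite CmulrnE.
by rewrite ltr_pdivrMr// mulr_natl ltNge => ->.
Qed.
Let Cunit_ge0 : 0 <= Ccst 1.
Proof. by apply/CleP => x; exact: ler01. Qed.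
Let Cunit f : exists n, vabs f <= Ccst 1 *+ n.
Proof.
have /compact_bounded[M [_ Mf]] : compact (range (Cval f)).
  apply: continuous_compact; last exact: compactT.
  by apply: continuous_subspaceT; exact: C_cts.
have [n Mn] : exists n : nat, forall x, `|Cval f x| <= n%:R.
  have := archi_boundP (normr_ge0 (M + 1)); set n := Num.bound _ => Mn.
  exists n => x; apply: Mf; last by exists x.
  by apply: lt_le_trans (ltW Mn); rewrite (lt_le_trans _ (ler_norm _))// ltrDl.
exists n; apply/CleP => x; rewrite CmulrnE.
by have := Mn x; rewrite ler_norml => /andP[h1 h2]; rewrite ge_max h2 lerNl h1.
Qed.
HB.instance Definition _ :=
  VectorLattice_isWStar.Build R C Carchi Cunit_ge0 Cunit.

End Cfun.

Section whom_theory.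
Variables (R : realType) (A B : wstarType R) (f : whom A B).

Lemma whom0 : f 0 = 0.
Proof. exact: linear0. Qed.

Lemma whomN x : f (- x) = - f x.
Proof. exact: linearN. Qed.

Lemma whom_abs x : f (vabs x) = vabs (f x).
Proof. by rewrite /vabs whom_join whomN. Qed.

Lemma whom_le x y : x <= y -> f x <= f y.
Proof.
move=> xy; have xyE : vmeet x y = x.
  by apply/le_anti; rewrite vleml vlexI lexx.
by rewrite -xyE whom_meet vlemr.
Qed.

Lemma preim_unit_maximal (P : set B) :
  unit_maximal P -> unit_maximal (f @^-1` P).
Proof.
move=> maxP; have [idP nPu _] := maxP.
have idfP : lideal (f @^-1` P).
  split=> [|x y /= Px Py|k x /= Px|x y /= Px yx].
  - by rewrite /= whom0; exact: lideal0.
  - by rewrite linearD; exact: lidealD.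
  - by rewrite linearZ; exact: lidealZ.
  - by apply: (lideal_solid idP Px); rewrite -!whom_abs; exact: whom_le.
split=> //=; first by rewrite whom_unit.
move=> J idJ nJu PJ; apply/seteqP; split => // a Ja.
have [r Pr] := residue_ex maxP (f a).
have Jr : J (a - r *: sunit).
  by apply: PJ; rewrite /= linearB linearZ /= whom_unit.
have Jru : J (r *: sunit).
  rewrite -[r *: _](subKr a); apply: (lidealD idJ) => //.
  exact: lidealN.
have [r0|r0] := eqVneq r 0; first by move: Pr; rewrite r0 scale0r subr0.
exfalso; apply: nJu; rewrite -[sunit]scale1r -(mulVf r0) -scalerA.
exact: lidealZ.
Qed.

(* Yf sends an ideal to its preimage under f; [nu_Ymap] below is the
   characterization nu_B (f a) = nu_A a \o Yf. *)
Definition yosida_map (P : yosida B) : yosida A :=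
  Yosida (preim_unit_maximal (yosidaP P)).

Lemma yosida_val_map a P : yosida_val (f a) P = yosida_val a (yosida_map P).
Proof.
apply: yosida_valE; have := yosida_valP a (yosida_map P).
by rewrite /= linearB linearZ /= whom_unit.
Qed.

End whom_theory.

Definition Yspace (R : realType) (A : wstarType R) : compHausType := yosida A.

Lemma yosida_map_continuous (R : realType) (A B : wstarType R) (f : whom A B) :
  continuous (yosida_map f : Yspace B -> Yspace A).
Proof.
apply/continuousP => _ [S ->]; exists (f @` S).
apply/seteqP; split=> P h hS; apply: h.
  by move=> a Sa; apply: hS; exists a.
by move=> _ [a Sa <-]; exact: hS.
Qed.

Definition Ymap (R : realType) (A B : wstarType R) (f : whom A B) :
  continuousType (Yspace B) (Yspace A) := mkcts (@yosida_map_continuous R A B f).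

Definition yosida_rep (R : realType) (A : wstarType R) (a : A) :
  Cfun R (Yspace A) := mkC (@yosida_val_continuous R A a).

Section nu.
Variables (R : realType) (A : wstarType R).
Let rep := @yosida_rep R A.

Let nu_linear : linear rep.
Proof. by move=> k a b; apply: CvalK => P; exact: yosida_val_linear. Qed.
Let nu_meet : {morph rep : x y / vmeet x y}.
Proof. by move=> a b; apply: CvalK => P; exact: yosida_val_meet. Qed.
Let nu_join : {morph rep : x y / vjoin x y}.
Proof. by move=> a b; apply: CvalK => P; exact: yosida_val_join. Qed.
Let nu_unit : rep sunit = sunit.
Proof. by apply: CvalK => P; exact: yosida_val_unit. Qed.

Definition nu : whom A (Cfun R (Yspace A)) :=
  WHom nu_linear nu_meet nu_join nu_unit.
End nu.

Section pullback.
Variables (R : realType) (X Y : compHausType) (g : continuousType Y X).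

Let pull_cts (h : Cfun R X) : continuous (Cval h \o g).
Proof. by move=> y; apply: continuous_comp; [exact: cts_fun|exact: C_cts]. Qed.

Definition pull (h : Cfun R X) : Cfun R Y := mkC (@pull_cts h).

Let pull_linear : linear pull.
Proof. by move=> k a b; apply: CvalK. Qed.
Let pull_meet : {morph pull : x y / vmeet x y}.
Proof. by move=> a b; apply: CvalK. Qed.
Let pull_join : {morph pull : x y / vjoin x y}.
Proof. by move=> a b; apply: CvalK. Qed.
Let pull_unit : pull sunit = sunit.
Proof. by apply: CvalK. Qed.

Definition Cmap : whom (Cfun R X) (Cfun R Y) :=
  WHom pull_linear pull_meet pull_join pull_unit.
End pullback.

Section comp.
Variables (R : realType) (A B C : wstarType R) (g : whom B C) (f : whom A B).

Let comp_linear : linear (g \o f).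
Proof. by move=> k a b; rewrite /= !linearP. Qed.
Let comp_meet : {morph g \o f : x y / vmeet x y}.
Proof. by move=> a b; rewrite /= !whom_meet. Qed.
Let comp_join : {morph g \o f : x y / vjoin x y}.
Proof. by move=> a b; rewrite /= !whom_join. Qed.
Let comp_unit : (g \o f) sunit = sunit.
Proof. by rewrite /= !whom_unit. Qed.

Definition whom_comp : whom A C :=
  WHom comp_linear comp_meet comp_join comp_unit.
End comp.

Lemma nu_Ymap (R : realType) (A B : wstarType R) (f : whom A B) (a : A) :
  Cval (nu B (f a)) =1 Cval (nu A a) \o Ymap f.
Proof. by move=> P; exact: yosida_val_map. Qed.

Definition whom_iso (R : realType) (A B : wstarType R) (f : whom A B) :=
  exists g : whom B A, cancel f g /\ cancel g f.

Definition essential_embedding (R : realType) (A B : wstarType R)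
    (f : whom A B) :=
  injective f /\
  forall b : B, 0 < b -> exists (a : A) (n : nat), 0 < a /\ f a <= b *+ n.

(* Essentiality of [ext_map] is required separately, in [in_V]. *)
Record ext_pair (R : realType) (A : wstarType R) := ExtPair {
  ext_alg : wstarType R;
  ext_map : whom A ext_alg }.

Definition ext_le (R : realType) (A : wstarType R) (B1 B2 : ext_pair A) :=
  exists f : whom (ext_alg B1) (ext_alg B2), ext_map B2 =1 f \o ext_map B1.

Definition ext_eq (R : realType) (A : wstarType R) (B1 B2 : ext_pair A) :=
  ext_le B1 B2 /\ ext_le B2 B1.

Section hull_operator.
Variables (R : realType) (c : forall X : compHausType, cov X).

Definition mu_alg (A : wstarType R) : wstarType R :=
  Cfun R (cov_space (c (Yspace A))).

Definition mu (A : wstarType R) : whom A (mu_alg A) :=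
  whom_comp (Cmap R (cov_map (c (Yspace A)))) (nu A).

End hull_operator.

(* A pair (X, f) with f : K -> X. *)
Record S_pair (K : compHausType) := SPair {
  S_space : compHausType;
  S_map : continuousType K S_space }.

(* (K, f) and (cX, c_X) are the same element of cov X. *)
Definition in_S (c : forall X, cov X) (K : compHausType) (X : S_pair K) :=
  exists fP : covering_map (S_map X), cov_eq (Cov fP) (c (S_space X)).

Definition S_le (K : compHausType) (X1 X2 : S_pair K) :=
  exists f : continuousType (S_space X2) (S_space X1),
    S_map X1 =1 f \o S_map X2.

(* A pair (A, f) with f : A -> H. *)
Record V_pair (R : realType) (H : wstarType R) := VPair {
  V_alg : wstarType R;
  V_map : whom V_alg H }.

(* (H, f) and (mu(c)A, mu(c)_A) are the same element of ext A. *)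
Definition in_V (R : realType) (c : forall X, cov X) (H : wstarType R)
    (A : V_pair H) :=
  essential_embedding (V_map A) /\
  ext_eq (ExtPair (V_map A)) (ExtPair (mu c (V_alg A))).

Definition V_le (R : realType) (H : wstarType R) (A1 A2 : V_pair H) :=
  exists f : whom (V_alg A1) (V_alg A2),
    essential_embedding f /\ V_map A1 =1 V_map A2 \o f.

Definition Y_pair (R : realType) (H : wstarType R) (M : V_pair H) :
  S_pair (Yspace H) := SPair (Ymap (V_map M)).

Definition Ffun (R : realType) (K : compHausType) : set (Cfun R K) :=
  [set f | finite_set (range (Cval f))].
Arguments Ffun R K : clear implicits.

(* The library's [zero_dimensional] only asks that clopen sets separate
   points. *)
Definition clopen_base (K : compHausType) := basis [set U : set K | clopen U].

(* Main.v *)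
Require Import Defs.
From HB Require Import structures.
From mathcomp Require Import all_boot all_order all_algebra.
From mathcomp Require Import all_classical all_reals topology normedtype.

(** The Yosida functor translates the algebraic question into a topological
    one: for an injective morphism f : A -> H, the pair (A, f) lies in V(H)
    exactly when the map Yf : YH -> YA lies in S(YH) ([in_V_in_S],
    [in_S_in_V]).  Two facts make this work.  An injective f is essential iff
    Yf is irreducible, because basic open sets of a Yosida space are cozero
    sets of elements of the algebra.  And mu(c)H = H makes H a copy of C(YH)
    with YH in fix(c), so that the minimality property of c gives one half of
    every comparison with cYA for free, and every continuous function on
    YH comes from an element of H.  Consequently C(X) is in
    V(H) for every X in S(YH) ([Cfun_in_V]), and every subalgebra of a member
    M of V(H) that still separates the points of YM is again in V(H), because
    it has the same Yosida space ([wsub_in_V]).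

    Suppose M is minimum.  Comparing M with the algebras C(X) shows that YM is
    minimum in S(YH).  Comparing M with its own point-separating subalgebras
    shows that there are no proper ones ([minimum_no_wsub]).  Now for a point
    p of YM, the elements of M that are constant on some neighborhood of p
    form a subalgebra, and it separates points, since of two distinct points
    one differs from p and can be cut out by a function vanishing near p and
    at the other point.  Hence every element of M is constant near every
    point.  Locally constant functions on a compact space have finite range,
    and their cozero sets are clopen, which gives both M = F(YM) and a clopen
    base.

    Conversely F(YA) is contained in A for every A ([Ffun_sub_range_nu]): this
    reduces to indicators of clopen sets, and the indicator of U is obtained
    from the unit, since the elements vanishing off U together with those
    vanishing on U generate an ideal that no point of YA contains.  So if YM is
    minimum and M = F(YM), then for A in V(H) the map YA -> YM pulls finite
    range functions back to finite range functions, hence M into A. *)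

Set Implicit Arguments.
Unset Strict Implicit.
Unset Printing Implicit Defensive.

Import Order.TTheory GRing.Theory Num.Theory.
Import numFieldNormedType.Exports.
Local Open Scope classical_set_scope.
Local Open Scope ring_scope.

(** * Subalgebras of a unital vector lattice *)

Record wsub (R : realType) (B : wstarType R) := WSub {
  wsub_set :> B -> Prop;
  wsub_linear : forall k x y, wsub_set x -> wsub_set y -> wsub_set (k *: x + y);
  wsub_meet : forall x y, wsub_set x -> wsub_set y -> wsub_set (vmeet x y);
  wsub_join : forall x y, wsub_set x -> wsub_set y -> wsub_set (vjoin x y);
  wsub_unit : wsub_set sunit }.

Definition wsub_type (R : realType) (B : wstarType R) (S : wsub B) :=
  {x : B | S x}.

HB.instance Definition _ (R : realType) (B : wstarType R) (S : wsub B) :=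
  gen_eqMixin (wsub_type S).
HB.instance Definition _ (R : realType) (B : wstarType R) (S : wsub B) :=
  gen_choiceMixin (wsub_type S).

Section wsub.
Variables (R : realType) (B : wstarType R) (S : wsub B).
Local Notation T := (wsub_type S).
Implicit Types a b c : T.

Lemma wsub_inj : injective (sval : T -> B).
Proof. by move=> [x Sx] [y Sy] /= xy; apply: eq_exist. Qed.

Let S0 : S 0.
Proof.
have := wsub_linear (-1) (wsub_unit S) (wsub_unit S).
by rewrite scaleN1r addNr.
Qed.
Let SZ k x : S x -> S (k *: x).
Proof. by move=> Sx; have := wsub_linear k Sx S0; rewrite addr0. Qed.
Let SD x y : S x -> S y -> S (x + y).
Proof. by move=> Sx; have := wsub_linear 1 Sx; rewrite scale1r => h /h. Qed.
Let SN x : S x -> S (- x).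
Proof. by move/(SZ (-1)); rewrite scaleN1r. Qed.

Definition wsub_zero : T := exist _ _ S0.
Definition wsub_add a b : T := exist _ _ (SD (svalP a) (svalP b)).
Definition wsub_opp a : T := exist _ _ (SN (svalP a)).
Definition wsub_scale k a : T := exist _ _ (SZ k (svalP a)).
Definition wsub_inf a b : T := exist _ _ (wsub_meet (svalP a) (svalP b)).
Definition wsub_sup a b : T := exist _ _ (wsub_join (svalP a) (svalP b)).
Definition wsub_one : T := exist _ _ (wsub_unit S).
Definition wsub_le a b := sval a <= sval b.

Let subDA : associative wsub_add.
Proof. by move=> a b c; apply: wsub_inj; exact: addrA. Qed.
Let subDC : commutative wsub_add.
Proof. by move=> a b; apply: wsub_inj; exact: addrC. Qed.
Let subD0 : left_id wsub_zero wsub_add.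
Proof. by move=> a; apply: wsub_inj; exact: add0r. Qed.
Let subDN : left_inverse wsub_zero wsub_opp wsub_add.
Proof. by move=> a; apply: wsub_inj; exact: addNr. Qed.
HB.instance Definition _ := GRing.isZmodule.Build T subDA subDC subD0 subDN.

Let subZA k l a : wsub_scale k (wsub_scale l a) = wsub_scale (k * l) a.
Proof. by apply: wsub_inj; exact: scalerA. Qed.
Let subZ1 : left_id 1 wsub_scale.
Proof. by move=> a; apply: wsub_inj; exact: scale1r. Qed.
Let subZDr : right_distributive wsub_scale +%R.
Proof. by move=> k a b; apply: wsub_inj; exact: scalerDr. Qed.
Let subZDl a : {morph wsub_scale^~ a : k l / k + l}.
Proof. by move=> k l; apply: wsub_inj; exact: scalerDl. Qed.
HB.instance Definition _ :=
  GRing.Zmodule_isLmodule.Build R T subZA subZ1 subZDr subZDl.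

Let sub_le_refl : reflexive wsub_le.
Proof. by move=> a; exact: lexx. Qed.
Let sub_le_anti : antisymmetric wsub_le.
Proof. by move=> a b /le_anti; exact: wsub_inj. Qed.
Let sub_le_trans : transitive wsub_le.
Proof. by move=> b a c; exact: le_trans. Qed.
HB.instance Definition _ :=
  Order.Le_isPOrder.Build ring_display T sub_le_refl sub_le_anti sub_le_trans.

Let sub_lexI a b c : (a <= wsub_inf b c) = (a <= b) && (a <= c).
Proof. exact: vlexI. Qed.
Let sub_leUx a b c : (wsub_sup a b <= c) = (a <= c) && (b <= c).
Proof. exact: vleUx. Qed.
Let sub_leD c a b : a <= b -> a + c <= b + c.
Proof. exact: vlerD2r. Qed.
Let sub_scale_ge0 (k : R) a : 0 <= k -> 0 <= a -> 0 <= k *: a.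
Proof. exact: vscaler_ge0. Qed.
HB.instance Definition _ :=
  POrdered_isVectorLattice.Build R T sub_lexI sub_leUx sub_leD sub_scale_ge0.

Let sub_mulrn a n : sval (a *+ n) = sval a *+ n.
Proof. by elim: n => // n ih; rewrite !mulrS -ih. Qed.

Let sub_archi a b : 0 <= a -> 0 <= b -> (forall n, a *+ n <= b) -> a = 0.
Proof.
move=> a0 b0 h; apply: wsub_inj.
apply: (@archimedeanP _ B (sval a) (sval b) a0 b0) => n.
by rewrite -sub_mulrn; exact: h.
Qed.
Let sub1_ge0 : 0 <= wsub_one.
Proof. exact: sunit_ge0. Qed.
Let sub1P a : exists n, vabs a <= wsub_one *+ n.
Proof.
have [n an] := sunitP (sval a); exists n.
by have : sval (vabs a) <= sval (wsub_one *+ n) by rewrite sub_mulrn.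
Qed.
HB.instance Definition _ :=
  VectorLattice_isWStar.Build R T sub_archi sub1_ge0 sub1P.

Let incl_linear : linear (sval : T -> B). Proof. by []. Qed.
Let incl_meet : {morph (sval : T -> B) : x y / vmeet x y}. Proof. by []. Qed.
Let incl_join : {morph (sval : T -> B) : x y / vjoin x y}. Proof. by []. Qed.
Let incl_unit : sval (sunit : T) = sunit. Proof. by []. Qed.
Definition wsub_incl : whom T B :=
  WHom incl_linear incl_meet incl_join incl_unit.

End wsub.

(** * Morphisms *)

(** Used with j the Yosida representation of H or of a member of V(H): a
    morphism into functions whose values all lie in the algebra is a morphism
    into the algebra. *)
Lemma whom_lift (R : numDomainType) (A B C : wstarType R)
    (j : whom A C) (k : whom B C) :
  injective j -> (forall b, exists a, j a = k b) ->
  exists e : whom B A, forall b, j (e b) = k b.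
Proof.
move=> jI /choice[e eE].
have e_lin : linear e.
  by move=> r x y; apply: jI; rewrite (whom_linear j) !eE (whom_linear k).
have e_meet : {morph e : x y / vmeet x y}.
  by move=> x y; apply: jI; rewrite whom_meet !eE whom_meet.
have e_join : {morph e : x y / vjoin x y}.
  by move=> x y; apply: jI; rewrite whom_join !eE whom_join.
have e_unit : e sunit = sunit by apply: jI; rewrite eE !whom_unit.
by exists (WHom e_lin e_meet e_join e_unit).
Qed.

Lemma whom_inj_le (R : realType) (A B : wstarType R) (f : whom A B) a b :
  injective f -> f a <= f b -> a <= b.
Proof.
move=> fI fab; suff <- : vmeet a b = a by exact: vlemr.
by apply: fI; rewrite whom_meet; apply/le_anti; rewrite vleml vlexI lexx fab.
Qed.

Lemma whom_inj_gt0 (R : realType) (A B : wstarType R) (f : whom A B) a :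
  injective f -> 0 < a -> 0 < f a.
Proof.
move=> fI a0; rewrite lt_neqAle -{2}(whom0 f) whom_le ?ltW// andbT -(whom0 f).
by apply/eqP => /fI a00; rewrite -a00 ltxx in a0.
Qed.

Section whom_morphism.
Variables (R : numDomainType) (A B : wstarType R) (f : whom A B).
Lemma whomD a b : f (a + b) = f a + f b. Proof. exact: linearD. Qed.
Lemma whomZ k a : f (k *: a) = k *: f a. Proof. exact: linearZ. Qed.
End whom_morphism.

(** * Compact Hausdorff spaces *)

Section compact_hausdorff.
Variables (X Y : compHausType).

Lemma closed_image (f : continuousType X Y) (F : set X) :
  closed F -> closed (f @` F).
Proof.
move=> cF; apply: compact_closed; first exact: hausdorffT.
apply: continuous_compact; first exact: continuous_subspaceT (@cts_fun _ _ f).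
exact: (subclosed_compact cF (@compactT X)).
Qed.

Lemma bijective_homeomorphism (f : continuousType X Y) :
  injective f -> range f = setT -> homeomorphism f.
Proof.
move=> fI fT; have /choice[g gK] : forall y, exists x, f x = y.
  by move=> y; have : range f y; [rewrite fT|case=> x _ <-; exists x].
have g_cts : continuous g.
  apply/continuous_closedP => F cF.
  rewrite (_ : g @^-1` F = f @` F); first exact: closed_image.
  apply/seteqP; split=> [y gy|_ [x Fx <-]]; first by exists (g y).
  by rewrite /preimage /= (fI _ _ (gK (f x))).
exists (mkcts g_cts); split=> x /=; last exact: gK.
by apply: fI; exact: gK.
Qed.

End compact_hausdorff.

Lemma Cfun_separates (R : realType) (X : compHausType) (x y : X) :
  (forall t : Cfun R X, Cval t x = Cval t y) -> x = y.
Proof.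
move=> txy; apply: contrapT => xy.
have nX : normal_space X.
  by apply: compact_normal; [exact: hausdorffT|exact: compactT].
have cl1 (z : X) : closed [set z].
  exact: (accessible_closed_set1 (hausdorff_accessible (@hausdorffT X))).
have xy0 : [set x] `&` [set y] = set0.
  by apply/seteqP; split=> // z [/= -> ?]; exact: xy.
have /(@uniform_separatorP _ R)[t [ct _ t0 t1]] :=
  iffLR (@normal_separatorP R X) nX _ _ (cl1 x) (cl1 y) xy0.
have tx : t x = 0 by apply: t0; exists x.
have ty : t y = 1 by apply: t1; exists y.
have := txy (mkC ct); rewrite /Cval /= /mkcts tx ty => /eqP.
by rewrite eq_sym oner_eq0.
Qed.

(** If the range of t is infinite, the complements of the preimages of finite
    sets generate a proper filter.  By compactness it clusters at some x, yet
    t avoids the value t x on one of its members and takes only this value near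
    x. *)
Lemma locally_constant_finite_range (R : realType) (X : compHausType)
    (t : Cfun R X) :
  (forall x, nbhs x [set y | Cval t y = Cval t x]) -> Ffun R X t.
Proof.
move=> tlc; apply: contrapT => infin.
pose F := filter_from [set D : set R | finite_set D]
                      (fun D => [set x | ~ D (Cval t x)]).
have FF : ProperFilter F.
  apply: filter_from_proper; last first.
    move=> D /= fD; apply: contrapT => D0; apply: infin.
    apply: sub_finite_set fD => _ [x _ <-]; apply: contrapT => nD.
    by apply: D0; exists x.
  apply: filter_from_filter; first by exists set0; exact: finite_set0.
  move=> D E fD fE; exists (D `|` E); first by rewrite /= finite_setU.
  by move=> x /= /not_orP.
have [x [_ clx]] := @compactT X F FF filterT.
have Fx : F [set y | Cval t y != Cval t x].
  by exists [set Cval t x]; [exact: finite_set1|move=> y /= /eqP].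
by have [y [/eqP]] := clx _ _ Fx (tlc x).
Qed.

Section Cval_morphism.
Variables (R : realType) (X : compHausType).
Implicit Types (s t : Cfun R X) (x : X).

Lemma Cval0 x : Cval (0 : Cfun R X) x = 0. Proof. by []. Qed.
Lemma Cval1 x : Cval (sunit : Cfun R X) x = 1. Proof. by []. Qed.
Lemma CvalD s t x : Cval (s + t) x = Cval s x + Cval t x. Proof. by []. Qed.
Lemma CvalN t x : Cval (- t) x = - Cval t x. Proof. by []. Qed.
Lemma CvalZ k t x : Cval (k *: t) x = k * Cval t x. Proof. by []. Qed.
Lemma Cval_meet s t x : Cval (vmeet s t) x = Num.min (Cval s x) (Cval t x).
Proof. by []. Qed.
Lemma Cval_join s t x : Cval (vjoin s t) x = Num.max (Cval s x) (Cval t x).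
Proof. by []. Qed.
Lemma Cval_abs t x : Cval (vabs t) x = `|Cval t x|.
Proof.
rewrite Cval_join CvalN; have [t0|t0] := leP 0 (Cval t x).
  by rewrite ger0_norm// max_l// (le_trans _ t0)// oppr_le0.
by rewrite ltr0_norm// max_r// (le_trans (ltW t0))// oppr_ge0 ltW.
Qed.

End Cval_morphism.

(** * Uniqueness of the Yosida space *)

(** A morphism j from A to C(X) sends each point x to the kernel of evaluation
    at x, which is a point of YA. *)
Section yosida_point.
Variables (R : realType) (X : compHausType) (A : wstarType R).
Variable j : whom A (Cfun R X).

(** Evaluation at x splits off the line of the unit, so every larger ideal
    contains a nonzero multiple of the unit. *)
Lemma yosida_pt_subproof (x : X) : unit_maximal [set a | Cval (j a) x = 0].
Proof.
have idx : lideal [set a | Cval (j a) x = 0].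
  split=> [|a b /= a0 b0|k a /= a0|a b /= a0 ba].
  - by rewrite /= whom0.
  - by rewrite whomD CvalD a0 b0 addr0.
  - by rewrite whomZ CvalZ a0 mulr0.
  - have /CleP/(_ x) := whom_le j ba; rewrite !whom_abs !Cval_abs a0 normr0.
    by rewrite normr_le0 => /eqP.
split=> //=; first by rewrite whom_unit Cval1; exact/eqP/oner_neq0.
move=> J idJ nJ xJ; apply/seteqP; split=> // a Ja.
apply: contrapT => /= /eqP ax.
apply: nJ; set r := Cval (j a) x.
have Jr : J (a - r *: sunit).
  apply: xJ; rewrite /= whomD whomN whomZ whom_unit.
  by rewrite CvalD CvalN CvalZ Cval1 mulr1 subrr.
rewrite -[sunit]scale1r -(mulVf ax) -scalerA; apply: (lidealZ idJ).
rewrite -[_ *: _](subKr a); apply: (lidealD idJ) => //; exact: lidealN.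
Qed.

Definition yosida_pt (x : X) : Yspace A := Yosida (yosida_pt_subproof x).

Lemma yosida_val_pt a x : Cval (nu A a) (yosida_pt x) = Cval (j a) x.
Proof.
apply: yosida_valE.
by rewrite /= whomD whomN whomZ whom_unit CvalD CvalN CvalZ Cval1 mulr1 subrr.
Qed.

Lemma yosida_pt_continuous : continuous yosida_pt.
Proof.
apply/continuousP => _ [S ->].
rewrite (_ : _ @^-1` _ = \bigcup_(a in S) [set x | Cval (j a) x != 0]).
  apply: bigcup_open => a _.
  apply: (@open_comp _ _ (Cval (j a)) [set r | r != 0]).
    by move=> x _; exact: C_cts.
  exact: open_neq.
apply/seteqP; split=> x /=.
  by move=> /existsNP[a /not_implyP[Sa /eqP]]; exists a.
by move=> [a Sa /= /eqP ax] h; apply: ax; exact: h.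
Qed.

Definition yosida_point : continuousType X (Yspace A) :=
  mkcts yosida_pt_continuous.

(** Surjectivity: the image is compact, hence closed, and it is dense because a
    basic open set is given by some a with j a different from 0. *)
Lemma yosida_point_homeomorphism :
  injective j ->
  (forall x y, (forall a, Cval (j a) x = Cval (j a) y) -> x = y) ->
  homeomorphism yosida_point.
Proof.
move=> jI sep; apply: bijective_homeomorphism => [x y xy|].
  by apply: sep => a; rewrite -!yosida_val_pt [yosida_pt x]xy.
apply: contrapT => nT.
have /closed_openC [S SE] : closed (range yosida_point).
  by apply: closed_image; exact: closedT.
have [P nP] : exists P, ~ range yosida_point P.
  apply: contrapT => /forallNP h; apply: nT; apply/seteqP; split=> // P _.
  exact: contrapT (h P).
have : (~` hull S) P by rewrite -SE.
move=> /existsNP[a /not_implyP[Sa nPa]].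
have [x ax] : exists x, Cval (j a) x != 0.
  apply: contrapT => /forallNP h; apply: nPa.
  suff -> : a = 0 by exact: lideal0 (yosida_lideal P).
  apply: jI; rewrite whom0; apply: CvalK => x.
  by have /negP/negPn/eqP := h x.
have : (~` range yosida_point) (yosida_point x).
  by rewrite SE => h; move/eqP: ax; apply; exact: h a Sa.
by apply; exists x.
Qed.

End yosida_point.

(** * Separation by elements of the algebra *)

Section yosida_separation.
Variables (R : realType) (A : wstarType R).
Local Notation val a P := (Cval (nu A a) P).

Lemma nu_abs a P : val (vabs a) P = `|val a P|.
Proof. by rewrite whom_abs Cval_abs. Qed.

Lemma nu_sunit P : val sunit P = 1.
Proof. by rewrite whom_unit. Qed.

Lemma nuZ k a P : val (k *: a) P = k * val a P.
Proof. by rewrite whomZ. Qed.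

Lemma nu_le a b P : a <= b -> val a P <= val b P.
Proof. by move=> /(whom_le (nu A))/CleP. Qed.

Lemma nu_eq P Q : (forall a, val a P = val a Q) -> P = Q.
Proof. exact: yosida_separates. Qed.

Lemma nu_gt0 a P : 0 <= a -> 0 < val a P -> 0 < a.
Proof.
move=> a0 aP; rewrite lt_neqAle a0 andbT; apply/eqP => a00.
by rewrite -a00 whom0 Cval0 ltxx in aP.
Qed.

(** A closed set is the hull of some S; take the absolute value of an element
    of S that P does not contain. *)
Lemma nu_separates_closed (F : set (Yspace A)) P : closed F -> ~ F P ->
  exists a, [/\ 0 <= a, forall Q, F Q -> val a Q = 0 & 0 < val a P].
Proof.
move=> /closed_openC[S SE] nFP.
have : (~` hull S) P by rewrite -SE.
move=> /existsNP[a /not_implyP[Sa nPa]]; exists (vabs a); split.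
- exact: vabs_ge0.
- move=> Q FQ; rewrite nu_abs; apply/eqP; rewrite normr_eq0; apply/eqP.
  apply/yosida_val0; suff : hull S Q by exact.
  by rewrite -[hull S]setCK -SE => /(_ FQ).
- rewrite nu_abs normr_gt0; apply/eqP => h; apply: nPa.
  exact/yosida_val0.
Qed.

(** The elements vanishing off U and those vanishing on U generate an ideal I.
    It is contained in no point of YA, since a point on either side of U is
    separated from the other side; so I contains the unit, which is then bounded
    by a + b with a vanishing off U and b vanishing on U.  This a is at least 1
    on U, and its meet with the unit is the indicator. *)
Lemma clopen_indicator (U : set (Yspace A)) : clopen U ->
  exists a, forall P, val a P = (P \in U)%:R.
Proof.
move=> [oU cU].
(* Asking only for a bound on the absolute value of y makes I solid by
   construction, without a Riesz decomposition. *)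
pose I := [set y : A | exists a b, [/\ forall P, U P -> val b P = 0,
  forall P, ~ U P -> val a P = 0, 0 <= a, 0 <= b & vabs y <= a + b]].
have I_off y : 0 <= y -> (forall P, ~ U P -> val y P = 0) -> I y.
  move=> y0 yU; exists y, 0; split=> //; last by rewrite vabs_id ?addr0.
  by move=> P _; rewrite whom0.
have I_on y : 0 <= y -> (forall P, U P -> val y P = 0) -> I y.
  move=> y0 yU; exists 0, y; split=> //; last by rewrite vabs_id ?add0r.
  by move=> P _; rewrite whom0.
have idI : lideal I.
  split.
  - by apply: I_off => // P _; rewrite whom0.
  - move=> x y [a [b [bU aU a0 b0 xab]]] [a' [b' [b'U a'U a'0 b'0 yab]]].
    exists (a + a'), (b + b'); split.
    + by move=> P UP; rewrite whomD CvalD bU// b'U// addr0.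
    + by move=> P UP; rewrite whomD CvalD aU// a'U// addr0.
    + by rewrite -[0]addr0; exact: vlerD.
    + by rewrite -[0]addr0; exact: vlerD.
    + by apply: (le_trans (vabsD _ _)); rewrite addrACA; exact: vlerD.
  - move=> k x [a [b [bU aU a0 b0 xab]]].
    exists (`|k| *: a), (`|k| *: b); split.
    + by move=> P UP; rewrite nuZ bU// mulr0.
    + by move=> P UP; rewrite nuZ aU// mulr0.
    + exact: vscaler_ge0.
    + exact: vscaler_ge0.
    + apply: (le_trans (vabsZ _ _)); rewrite -scalerDr; exact: vlerZ.
  - move=> x y [a [b [bU aU a0 b0 xab]]] yx; exists a, b; split=> //.
    exact: le_trans yx xab.
have [a [b [bU aU a0 b0]]] : I sunit.
  apply: contrapT => nI; have [P [maxP IP]] := unit_maximal_ex idI nI.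
  pose p : Yspace A := Yosida maxP.
  have in_point y : I y -> val y p = 0 by move=> /IP Py; exact/yosida_val0.
  have [Up|nUp] := pselect (U p).
    have [|a [a0 aU]] := @nu_separates_closed (~` U) p (open_closedC oU).
      by apply.
    by rewrite (in_point _ (I_off _ a0 aU)) ltxx.
  have [b [b0 bU]] := nu_separates_closed cU nUp.
  by rewrite (in_point _ (I_on _ b0 bU)) ltxx.
rewrite vabs_id ?sunit_ge0// => uab.
exists (vmeet a sunit) => P; rewrite whom_meet Cval_meet nu_sunit.
have := nu_le P uab; rewrite whomD CvalD nu_sunit => hP.
have [UP|nUP] := pselect (U P).
  by rewrite mem_set// min_r//; rewrite bU// addr0 in hP.
by rewrite memNset// aU// min_l.
Qed.

(** The fibres of a continuous function of finite range are clopen, being closed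
    and complements of finite unions of fibres, and the function is a
    combination of their indicators. *)
Lemma Ffun_sub_range_nu : Ffun R (Yspace A) `<=` range (nu A).
Proof.
move=> t; rewrite /Ffun /= => /finite_seqP[s sE].
have ts P : Cval t P \in s.
  by have : range (Cval t) (Cval t P); [exists P|rewrite sE].
have tclopen r : clopen [set P | Cval t P = r].
  have cl1 (B : set R) : finite_set B -> closed [set P | B (Cval t P)].
    move=> fB; apply: (@preimage_closed _ _ (Cval t) B); last first.
      exact: (iffLR accessible_finite_set_closed
        (hausdorff_accessible (@Rhausdorff R))).
    by move=> P _; exact: C_cts.
  split; last exact: (cl1 [set r] (finite_set1 r)).
  rewrite -closedC.
  rewrite (_ : ~` _ = [set P | ([set` s] `\` [set r]) (Cval t P)]).
    exact: (cl1 ([set` s] `\` [set r]) (finite_setD _ (finite_seq s))).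
  apply/seteqP; split=> P /=; last by case.
  by split; first exact: ts.
have /choice[e eE] r := clopen_indicator (tclopen r).
(* The enumeration s may repeat values; each must be counted once. *)
exists (\sum_(r <- undup s) r *: e r) => //; apply: CvalK => P.
have sumE (l : seq R) : Cval (nu A (\sum_(r <- l) r *: e r)) P =
    \sum_(r <- l) r * (Cval t P == r)%:R.
  elim: l => [|r l ih]; first by rewrite !big_nil whom0.
  rewrite !big_cons whomD CvalD ih; congr (_ + _).
  rewrite nuZ eE; congr (_ * _%:R).
  by congr nat_of_bool; apply/idP/eqP; rewrite inE.
rewrite sumE (bigD1_seq (Cval t P)) ?undup_uniq//=; last first.
  by rewrite mem_undup.
rewrite eqxx mulr1 big1 ?addr0// => r /negPf.
by rewrite eq_sym => ->; rewrite mulr0.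
Qed.

End yosida_separation.

(** * Covering maps *)

Lemma covering_map_homeo (X Y Z : compHausType) (f : continuousType X Y)
    (h : continuousType Y Z) (g : continuousType X Z) :
  covering_map f -> homeomorphism h -> g =1 h \o f -> covering_map g.
Proof.
move=> [fT firr] [k [hk kh]] ghf.
have gE (F : set X) : g @` F = h @` (f @` F).
  by rewrite image_comp; apply: eq_imagel => x _; exact: ghf.
have hT : range h = setT.
  by apply/seteqP; split=> // z _; exists (k z).
split=> [|F cF FT gFT]; first by rewrite gE fT.
apply: (firr F cF FT); apply/seteqP; split=> // y _.
have [_ [x Fx <-] /(can_inj hk) <-] : (h @` (f @` F)) (h y) by rewrite -gE gFT.
by exists x.
Qed.

(** Membership in S(K) depends on the target only up to homeomorphism although
    c need not commute with homeomorphisms.  The cover K of Z is above cZ by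
    minimality of cZ, as K is in fix(c).  Conversely cZ, seen as a cover of X
    through the inverse of h, is above cX by minimality of cX, and cX is
    equivalent to K. *)
Lemma in_S_homeo (c : forall X, cov X) (K X Z : compHausType)
    (f : continuousType K X) (h : continuousType X Z) (g : continuousType K Z) :
  covering_operator c -> fix_cov c K ->
  homeomorphism h -> g =1 h \o f -> in_S c (SPair f) -> in_S c (SPair g).
Proof.
move=> hc fixK hh ghf [/= fP [[w wE] _]].
have gP : covering_map g by exact: covering_map_homeo fP hh ghf.
exists gP; split; last first.
  by have [_] := hc Z; apply.
have [k [hk kh]] := hh.
have kP : homeomorphism k by exists h.
have pP : covering_map (k \o cov_map (c Z)).
  exact: covering_map_homeo (cov_mapP (c Z)) kP _.
have [fixcZ _] := hc Z.
have [_ /(_ (Cov pP) fixcZ) [v vE]] := hc X.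
exists (w \o v) => z /=.
have := wE (v z); rewrite /= ghf /= => <-.
by rewrite -[cov_map (c X) (v z)]/((cov_map (c X) \o v) z) -vE /= kh.
Qed.

(** * Essential embeddings and irreducible maps *)

Section pairs.
Variables (R : realType) (A B : wstarType R) (f : whom A B).

Lemma Ymap_val a P : Cval (nu A a) (Ymap f P) = Cval (nu B (f a)) P.
Proof. by rewrite nu_Ymap. Qed.

Hypothesis nuI : injective (nu B).

Lemma nu_pos_ex (b : B) : 0 < b -> exists P, 0 < Cval (nu B b) P.
Proof.
move=> b0; apply: contrapT => /forallNP h.
suff b00 : b = 0 by rewrite b00 ltxx in b0.
apply: nuI; apply: CvalK => P; apply/le_anti; rewrite whom0 Cval0.
have := nu_le P (ltW b0); rewrite whom0 Cval0 => ->; rewrite andbT leNgt.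
exact/negP/h.
Qed.

(** If F is proper, some b > 0 vanishes on F, and essentiality puts a nonzero
    f a below a multiple of b.  Then a vanishes on the image of F, which
    therefore cannot be all of YA. *)
Lemma essential_irreducible (F : set (Yspace B)) :
  essential_embedding f -> closed F -> F <> setT -> Ymap f @` F <> setT.
Proof.
move=> [fI fE] cF FT fFT; apply: FT; apply/seteqP; split=> // P _.
apply: contrapT => nFP; have [b [b0 bF bP]] := nu_separates_closed cF nFP.
have [a [n [a0 fab]]] := fE b (nu_gt0 b0 bP).
have [Q] := nu_pos_ex (whom_inj_gt0 fI a0); rewrite -Ymap_val.
have [Q' FQ' <-] : (Ymap f @` F) (Ymap f Q) by rewrite fFT.
rewrite Ymap_val ltNge (le_trans (nu_le Q' fab))//.
by rewrite raddfMn CmulrnE bF// mul0rn.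
Qed.

(** Given b > 0, let F be the set where b is at most half of some positive
    value.  By irreducibility some a > 0 vanishes on the image of F; then f a
    vanishes on F, while off F the bounded f a is below a multiple of b. *)
Lemma covering_essential :
  injective f -> covering_map (Ymap f) -> essential_embedding f.
Proof.
move=> fI [fT firr]; split=> // b b0.
have [P bP] := nu_pos_ex b0.
pose F := [set Q | Cval (nu B b) Q <= Cval (nu B b) P / 2].
have cF : closed F.
  apply: (@preimage_closed _ _ (Cval (nu B b)) [set r | r <= _ / 2]).
    by move=> Q _; exact: C_cts.
  exact: closed_le.
have FT : F <> setT.
  move=> FT; have : F P by rewrite FT.
  by rewrite /F /= leNgt ltr_pdivrMr// ltr_pMr// ltr1n.
have [Q nQ] : exists Q, ~ (Ymap f @` F) Q.
  apply: contrapT => /forallNP h; apply: (firr F cF FT).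
  by apply/seteqP; split=> // Q _; exact: contrapT (h Q).
have [a [a0 aF aQ]] := nu_separates_closed (closed_image cF) nQ.
have [N aN] := sunitP a; rewrite vabs_id// in aN.
have e0 : 0 < Cval (nu B b) P / 2 by rewrite divr_gt0.
pose n := Num.bound (N%:R / (Cval (nu B b) P / 2)).
have nP : N%:R <= (Cval (nu B b) P / 2) *+ n.
  rewrite -[leRHS]mulr_natl -ler_pdivrMr//; apply/ltW/archi_boundP.
  by rewrite divr_ge0// ltW.
exists a, n; split; first exact: nu_gt0 a0 aQ.
apply: (whom_inj_le nuI); apply/CleP => Q'.
rewrite raddfMn CmulrnE -Ymap_val.
have [FQ'|nFQ'] := pselect (F Q').
  rewrite aF; last by exists Q'.
  by rewrite mulrn_wge0//; have := nu_le Q' (ltW b0); rewrite whom0.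
apply: (le_trans (nu_le _ aN)); rewrite raddfMn CmulrnE nu_sunit.
apply: (le_trans nP); rewrite lerMn2r; apply/orP; right.
by rewrite leNgt; apply/negP => /ltW.
Qed.

End pairs.

(** * The correspondence between V(H) and S(YH) *)

Section hull.
Variables (R : realType) (c : forall X : compHausType, cov X).
Hypothesis hc : covering_operator c.
Variable H : wstarType R.
Hypothesis hH : whom_iso (mu c H).

Lemma mu_fix_nu_inj : injective (nu H).
Proof.
have [g [muK _]] := hH; move=> a b ab; apply: (can_inj muK).
by rewrite -[mu c H a]/(pull _ (nu H a)) ab.
Qed.

Lemma mu_fix_nu_surj (t : Cfun R (Yspace H)) : exists h, nu H h = t.
Proof.
have [g [_ muK]] := hH; exists (g (pull (cov_map (c (Yspace H))) t)).
have [cT _] := cov_mapP (c (Yspace H)).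
apply: CvalK => P; have : range (cov_map (c (Yspace H))) P by rewrite cT.
case=> q _ <-.
by have /(congr1 (fun t => Cval t q)) := muK (pull (cov_map (c (Yspace H))) t).
Qed.

(** As mu(c)_H is onto, every function in C(cYH) factors through c_YH and is
    constant on its fibres; C(cYH) separates points, so these fibres are
    points. *)
Lemma mu_fix_space : fix_cov c (Yspace H).
Proof.
have [g [_ muK]] := hH; have [cT _] := cov_mapP (c (Yspace H)).
apply: bijective_homeomorphism => // p q pq; apply: (@Cfun_separates R) => t.
rewrite -(muK t).
by rewrite -[LHS]/(Cval (nu H (g t)) (cov_map (c (Yspace H)) p)) pq.
Qed.

Let nuI := mu_fix_nu_inj.

(** The extension morphism g from H to C(cYA) gives a map cYA -> YH over YA, so
    Yf is onto because c_YA is.  The comparison in the other direction is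
    minimality of c_YA among covers with space in fix(c). *)
Lemma in_V_in_S (A : V_pair H) : in_V c A -> in_S c (Y_pair A).
Proof.
move=> [fE [[g gE] _]]; set f := V_map A in fE gE *.
have phiE p : cov_map (c (Yspace (V_alg A))) p = Ymap f (yosida_point g p).
  apply: nu_eq => a; rewrite Ymap_val yosida_val_pt.
  by have := gE a => /= <-.
have fP : covering_map (Ymap f).
  split=> [|F]; last exact: essential_irreducible.
  apply/seteqP; split=> // Q _.
  have [cT _] := cov_mapP (c (Yspace (V_alg A))).
  have : range (cov_map (c (Yspace (V_alg A)))) Q by rewrite cT.
  by case=> p _ <-; exists (yosida_point g p).
exists fP; split; first by exists (yosida_point g).
by have [_] := hc (Yspace (V_alg A)); apply; exact: mu_fix_space.
Qed.

(** The two maps between YH and cYA over YA induce the morphisms between C(cYA)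
    and C(YH), a copy of H. *)
Lemma in_S_in_V (A : V_pair H) :
  injective (V_map A) -> in_S c (Y_pair A) -> in_V c A.
Proof.
move=> fI [/= fP [[phi phiE] [psi psiE]]].
split; first exact: covering_essential.
split.
  exists (whom_comp (Cmap R phi) (nu H)) => a; apply: CvalK => p.
  rewrite -[LHS]/(Cval (nu (V_alg A) a) (cov_map (c (Yspace (V_alg A))) p)).
  by rewrite phiE; exact: (Ymap_val (V_map A) a (phi p)).
have [g gE] := whom_lift (k := Cmap R psi) nuI (fun t => mu_fix_nu_surj _).
exists g => a; apply: nuI; rewrite gE; apply: CvalK => P.
by rewrite -Ymap_val [Ymap _ _]psiE.
Qed.

(** The Yosida space of C(X) is X, and the embedding of C(X) in H dual to the
    covering map induces this covering map. *)
Lemma Cfun_in_V (X : S_pair (Yspace H)) : in_S c X ->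
  exists f : whom (Cfun R (S_space X)) H,
    (forall t, nu H (f t) = pull (S_map X) t) /\ in_V c (VPair f).
Proof.
case: X => X g hX; have [gP _] := hX; rewrite /= in gP *; have [gT _] := gP.
have [f fE] := whom_lift (k := Cmap R g) nuI (fun t => mu_fix_nu_surj _).
exists f; split=> //; apply: in_S_in_V => [s t st|] /=.
  apply: CvalK => x; have : range g x by rewrite gT.
  case=> P _ <-; rewrite -[LHS]/(Cval (pull g s) P) -[RHS]/(Cval (pull g t) P).
  by rewrite -[pull g s]fE -[pull g t]fE st.
pose j := Cmap R [the continuousType X X of @idfun X].
apply: (@in_S_homeo c _ _ _ _ (yosida_point j)) hX => //.
- exact: mu_fix_space.
- apply: yosida_point_homeomorphism => [s t st|x y xy].
    by apply: CvalK => x; have /(congr1 (fun t => Cval t x)) := st.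
  by apply: (@Cfun_separates R) => t; have := xy t.
- move=> P; apply: nu_eq => t; rewrite Ymap_val fE.
  exact: (esym (yosida_val_pt j t (g P))).
Qed.

Lemma in_V_nu_inj (A : V_pair H) : in_V c A -> injective (nu (V_alg A)).
Proof.
move=> [[fI _] _] a b ab; apply: fI; apply: nuI; apply: CvalK => P.
by rewrite -!Ymap_val ab.
Qed.

(** S and M have the same Yosida space because S separates the points of YM. *)
Lemma wsub_in_V (M : V_pair H) (S : wsub (V_alg M)) : in_V c M ->
  (forall P Q, (forall a, S a -> Cval (nu _ a) P = Cval (nu _ a) Q) -> P = Q) ->
  in_V c (VPair (whom_comp (V_map M) (wsub_incl S))).
Proof.
move=> hM sep; have [[mI _] _] := hM.
apply: in_S_in_V => [|/=]; first exact: inj_comp mI (@wsub_inj _ _ S).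
pose j := whom_comp (nu (V_alg M)) (wsub_incl S).
apply: (@in_S_homeo c _ _ _ (Ymap (V_map M)) (yosida_point j))
  (in_V_in_S hM) => //.
- exact: mu_fix_space.
- apply: yosida_point_homeomorphism => [|P Q PQ].
    exact: inj_comp (in_V_nu_inj hM) (@wsub_inj _ _ S).
  by apply: sep => a Sa; exact: (PQ (exist _ a Sa)).
- move=> P; apply: nu_eq => a; rewrite Ymap_val.
  have := yosida_val_pt j a (Ymap (V_map M) P).
  by rewrite [j a]/(nu _ (sval a)) Ymap_val => <-.
Qed.

(** S is in V(H), so M embeds in S over H, and an embedding over H from M into
    a subalgebra of M can only be the identity. *)
Lemma minimum_no_wsub (M : V_pair H) (S : wsub (V_alg M)) :
  minimum (@V_le R H) (@in_V R c H) M ->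
  (forall P Q, (forall a, S a -> Cval (nu _ a) P = Cval (nu _ a) Q) -> P = Q) ->
  forall a, S a.
Proof.
move=> [hM minM] sep a; have [[mI _] _] := hM.
have [e [_ eE]] := minM _ (wsub_in_V hM sep).
by rewrite (mI _ _ (eE a)); exact: svalP.
Qed.

(** * Minimum elements *)

Section constant_near.
Variables (A : wstarType R) (X : compHausType) (v : whom A (Cfun R X)) (p : X).
Let S : set A := [set a | nbhs p [set q | Cval (v a) q = Cval (v a) p]].

Let S_linear k x y : S x -> S y -> S (k *: x + y).
Proof.
by apply: filterS2 => q xq yq; rewrite /= !whomD !CvalD !whomZ !CvalZ xq yq.
Qed.
Let S_meet x y : S x -> S y -> S (vmeet x y).
Proof.
by apply: filterS2 => q xq yq; rewrite /= !whom_meet !Cval_meet xq yq.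
Qed.
Let S_join x y : S x -> S y -> S (vjoin x y).
Proof.
by apply: filterS2 => q xq yq; rewrite /= !whom_join !Cval_join xq yq.
Qed.
Let S_unit : S sunit.
Proof. by apply: filterS filterT => q _; rewrite /= !whom_unit. Qed.

Definition constant_near : wsub A := WSub S_linear S_meet S_join S_unit.

End constant_near.

(** Of two distinct points, at least one, say Q', differs from p; a function
    that vanishes on a neighborhood of p and at the other point P', but not at
    Q', is constant near p and separates them. *)
Lemma constant_near_separates (A : wstarType R) (p P Q : Yspace A) :
  (forall a, constant_near (nu A) p a ->
    Cval (nu A a) P = Cval (nu A a) Q) -> P = Q.
Proof.
have main P' Q' : P' != Q' -> Q' != p ->
    exists2 a, constant_near (nu A) p a & Cval (nu A a) P' <> Cval (nu A a) Q'.
  move=> PQ Qp; have := @hausdorffT (Yspace A); rewrite open_hausdorff.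
  move=> /(_ _ _ Qp)[[U V] /= [/set_mem UQ /set_mem Vp] [oU oV /eqP UV]].
  have cF : closed (~` U `|` [set P']).
    apply: closedU; first exact: open_closedC.
    apply: accessible_closed_set1; apply: hausdorff_accessible.
    exact: hausdorffT.
  have nFQ : ~ (~` U `|` [set P']) Q'.
    by case=> [//|/= QP]; move/eqP: PQ; apply; rewrite QP.
  have [a [a0 aF aQ]] := nu_separates_closed cF nFQ.
  have VF : V `<=` ~` U `|` [set P'].
    by move=> z Vz; left => Uz; have : (U `&` V) z by []; rewrite UV.
  exists a; last first.
    have aP : Cval (nu A a) P' = 0 by apply: aF; right.
    move=> aPQ; have aQ0 : Cval (nu A a) Q' = 0 by rewrite -aP; exact: esym.
    by rewrite aQ0 ltxx in aQ.
  apply: (filterS (P := V)); last exact: open_nbhs_nbhs.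
  by move=> z Vz; exact: etrans (aF _ (VF _ Vz)) (esym (aF _ (VF _ Vp))).
move=> PQ; apply: contrapT => /eqP nPQ.
have [Qp|Qp] := eqVneq Q p.
  have Pp : P != p by rewrite -Qp.
  rewrite eq_sym in nPQ; have [a Sa] := main _ _ nPQ Pp.
  by apply; rewrite PQ.
by have [a Sa] := main _ _ nPQ Qp; apply; exact: PQ.
Qed.

(** A map X -> YM under YH comes from the embedding of M in C(X).  Clopen sets
    form a base because cozero sets of elements of M do, and those of locally
    constant functions are clopen. *)
Lemma minimum_V_Ffun (M : V_pair H) : minimum (@V_le R H) (@in_V R c H) M ->
  [/\ minimum (@S_le (Yspace H)) (@in_S c (Yspace H)) (Y_pair M),
      clopen_base (Yspace (V_alg M))
    & range (nu (V_alg M)) = Ffun R (Yspace (V_alg M))].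
Proof.
move=> minM; have [hM leM] := minM.
have loc a p :
    nbhs p [set Q | Cval (nu (V_alg M) a) Q = Cval (nu (V_alg M) a) p].
  exact: (minimum_no_wsub minM (@constant_near_separates _ p)).
split.
- split=> [|X hX]; first exact: in_V_in_S.
  have [f [fE fV]] := Cfun_in_V hX; have [e [_ eE]] := leM _ fV.
  exists (yosida_point e) => P; apply: nu_eq => a.
  rewrite Ymap_val (eE a : V_map M a = f (e a)) fE.
  exact: (esym (yosida_val_pt e a (S_map X P))).
- split=> [U []//|p U]; rewrite nbhsE => -[V [oV Vp] VU].
  have nVp : ~ (~` V) p by apply.
  have [a [a0 aV ap]] := nu_separates_closed (open_closedC oV) nVp.
  exists [set Q | Cval (nu (V_alg M) a) Q != 0]; last first.
    move=> Q /= aQ; apply: VU; apply: contrapT => nVQ.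
    by move/eqP: aQ; apply; exact: aV.
  split; last by rewrite /= gt_eqF.
  split.
    apply: (@open_comp _ _ (Cval (nu (V_alg M) a)) [set r | r != 0]).
      by move=> x _; exact: C_cts.
    exact: open_neq.
  rewrite -openC openE => Q /= /negP/negPn/eqP aQ.
  by apply: filterS (loc a Q) => z /= ->; rewrite aQ eqxx.
- apply/seteqP; split=> [_ [a _ <-]|]; last exact: Ffun_sub_range_nu.
  by apply: locally_constant_finite_range => p; exact: loc.
Qed.

(** For A in V(H), minimality of YM gives a map YA -> YM under YH.  Pulling back
    along it sends M = F(YM) into F(YA), and F(YA) is contained in A.  The
    resulting morphism is essential because M is already essential in H. *)
Lemma Ffun_minimum_V (M : V_pair H) : in_V c M ->
  minimum (@S_le (Yspace H)) (@in_S c (Yspace H)) (Y_pair M) ->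
  range (nu (V_alg M)) = Ffun R (Yspace (V_alg M)) ->
  minimum (@V_le R H) (@in_V R c H) M.
Proof.
move=> hM [_ minY] MF; split=> // A hA; have [[mI mE] _] := hM.
have [[fI _] _] := hA.
have [th thE] := minY _ (in_V_in_S hA).
have [e eE] : exists e : whom (V_alg M) (V_alg A),
    forall a, nu (V_alg A) (e a) = pull th (nu (V_alg M) a).
  apply: (whom_lift (k := whom_comp (Cmap R th) (nu _)) (in_V_nu_inj hA)) => a.
  have [|b _ bE] := @Ffun_sub_range_nu R (V_alg A) (pull th (nu _ a));
    last by exists b.
  have : Ffun R _ (nu (V_alg M) a) by rewrite -MF; exists a.
  by apply: sub_finite_set => _ [P _ <-]; exists (th P).
have meE a : V_map M a = V_map A (e a).
  apply: nuI; apply: CvalK => P.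
  rewrite -(Ymap_val (V_map M)) -(Ymap_val (V_map A)) eE.
  by rewrite [Ymap (V_map M) P]thE.
exists e; split=> //; split=> [a b ab|b b0].
  by apply: mI; rewrite !meE ab.
have [a [n [a0 man]]] := mE _ (whom_inj_gt0 fI b0); exists a, n; split=> //.
by apply: (whom_inj_le fI); rewrite -meE raddfMn.
Qed.

End hull.

Theorem theorem7p5 (R : realType) (c : forall X : compHausType, cov X)
    (hc : covering_operator c) (H : wstarType R) (hH : whom_iso (mu c H))
    (M : V_pair H) (hM : in_V c M) :
  minimum (@V_le R H) (@in_V R c H) M <->
  [/\ minimum (@S_le (Yspace H)) (@in_S c (Yspace H)) (Y_pair M),
      clopen_base (Yspace (V_alg M))
    & range (nu (V_alg M)) = Ffun R (Yspace (V_alg M))].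
Proof.
split; first exact: minimum_V_Ffun.
by case=> minY _ MF; exact: (Ffun_minimum_V hc hH hM minY MF).
Qed.
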